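(* Every topological group embeds, as a topological subgroup, into an extremely amenable topological group, that is, a topological group with the fixed point on compacta property.
   Context: A topological group has the fixed point on compacta property (is extremely amenable) if every continuous action of it on a (nonempty) compact space has a fixed point. *)

(* Defs.v *)
From HB Require Import structures.
From mathcomp Require Import all_boot all_classical all_analysis.

Set Implicit Arguments.
Unset Strict Implicit.
Unset Printing Implicit Defensive.

Local Open Scope classical_set_scope.
Local Open Scope group_scope.

(* No separation axiom is built into the structure: hausdorff_space is stated
   separately where it is wanted. *)
HB.mixin Record isTopologicalGroup G & Group G & Topological G := {
  mulg_continuous : continuous (fun x : G * G => x.1 * x.2) ;
  invg_continuous : continuous (fun x : G => x^-1)
}.

#[short(type="topologicalGroupType")]
HB.structure Definition TopologicalGroup :=
  {G of Group G & Topological G & isTopologicalGroup G}.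

(* Joint continuity: act is continuous on the product G * X. *)
Definition continuous_action (G : topologicalGroupType) (X : topologicalType)
    (act : G -> X -> X) : Prop :=
  [/\ forall x, act 1 x = x,
      forall g h x, act (g * h) x = act g (act h x) &
      continuous (fun p : G * X => act p.1 p.2)].

(* Compact spaces are Hausdorff by convention; without this clause the property
   would only hold for the trivial group, since any group acts freely and
   continuously by translations on itself with the indiscrete topology. *)
Definition extremely_amenable (G : topologicalGroupType) : Prop :=
  forall (X : topologicalType) (act : G -> X -> X),
    [set: X] !=set0 -> compact [set: X] -> hausdorff_space X ->
    continuous_action act ->
    exists x : X, forall g : G, act g x = x.

(* An injective homomorphism which is a homeomorphism onto its range, the range
   carrying the subspace topology. *)
Definition topological_group_embedding (G H : topologicalGroupType)
    (f : G -> H) : Prop :=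
  [/\ {morph f : x y / x * y}, injective f, continuous f &
      forall U : set G, open U ->
        exists2 V : set H, open V & f @` U = V `&` range f].

(* Main.v *)
Require Import Defs.
From HB Require Import structures.
From mathcomp Require Import all_boot all_order all_algebra all_fingroup.
From mathcomp Require Import all_classical all_analysis.
From mathcomp Require Import zify ring lra.

(** The group [H] is the group of all isometries, with the topology of
    pointwise convergence, of a very homogeneous metric space on which [G] acts
    continuously by isometries.  A distance is given by the relation
    [dist_le x y c], read d(x, y) <= c, with rational [c]; the largest distance
    subject to some constraints is then an inductive relation (chains of moves),
    and no infimum has to be taken.

    Construction of the space.  The Birkhoff-Kakutani chain distances turn
    copies of [G] into spaces on which [G] acts by isometries; they generate the
    topology of [G].  Together with all distances on the natural numbers they
    form [base_space].  The extension [iso_ext X] freely adjoins to [X] a letter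
    for each finite partial isometry p : a_k |-> b_k of [X].  Its distance is the
    largest one, invariant under the new letters, for which p sends a_k to b_k
    and replacing a letter p by a letter q costs at most the sum of the
    displacements of their entries.  This last constraint is what makes the
    action of [G] on the extension continuous: when g is close to the identity
    on the finitely many entries of a word, it hardly moves the word.  The heart
    of the construction is that [X] embeds isometrically ([to_ext_isometry]).
    Picture a chain of moves from a point of [X] to another one as a planar
    diagram in which every letter traces a wall.  A wall ends only where the
    moving point crosses it, and removing an innermost wall never increases the
    cost; so the chain can be replaced by moves inside [X].  The relation
    [reduction] is an algebraic substitute for that picture.  In the limit of
    the iterated extensions every finite partial isometry extends to an
    isometry ([lim_homogeneous]), and every isometry of the base extends
    functorially ([lim_map]).

    Extreme amenability ([ptw_extremely_amenable]).  For a flow without fixed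
    point, compactness gives finitely many sets W_s covering the flow and
    elements g_s such that g_s W_s is disjoint from W_s.  The orbit of a point
    colours [H] by the indices s, and it suffices to find h such that h and h a_s,
    with a_s the inverse of g_s, are both close on finitely many given points o_i
    to elements of colour s ([near_constant_pair]).  Let [K] be the finite group of
    permutations of a large finite ball of [H], and k_s in [K] a permutation which
    agrees with right multiplication by a_s as long as one stays in the ball.
    Glue together, one copy for each x in the cube K^N, copies of the finite
    configuration of the points a_s o_i and o_i, in such a way that the part
    a_s o_i of the copy x is close to the part o_i of the copy x k_s and the
    copies vary slowly with x for the normalised Hamming distance.  There are no
    shortcuts in the resulting space ([model_line]): a path of cost less than 1
    makes few jumps and leaves some coordinate of the cube unchanged, so that a
    path from a copy to itself spells a short word which is trivial in [K], hence
    in [H].  By homogeneity the copies are the images of the configuration under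
    isometries h_x.  Finally, by concentration of measure on K^N, some colour s is
    met near x and near x k_s ([near_monochromatic]).

    If [G] is not Hausdorff, the action on the metric space is not faithful; the
    group of isometries is then multiplied by [G], acting through the first
    factor. *)

Set Implicit Arguments.
Unset Strict Implicit.
Unset Printing Implicit Defensive.
Import Order.TTheory GRing.Theory Num.Theory.
Local Open Scope ring_scope.

(** * Distance spaces *)

(** A pseudo-metric bounded by 1, given by the relation d(x, y) <= c.  The
    relations generated inductively below satisfy these axioms; they become
    closed in [c], as the relation of an actual real distance is, by
    [closure_space]. *)
Record preDistSpace := PreDistSpace {
  dist_carrier :> Type;
  pre_dist : dist_carrier -> dist_carrier -> rat -> Prop;
  pre_dist_refl : forall x, pre_dist x x 0;
  pre_dist_sym : forall x y c, pre_dist x y c -> pre_dist y x c;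
  pre_dist_trans : forall x y z c e, pre_dist x y c -> pre_dist y z e -> pre_dist x z (c + e);
  pre_dist_mono : forall x y c e, c <= e -> pre_dist x y c -> pre_dist x y e;
  pre_dist_ge0 : forall x y c, pre_dist x y c -> 0 <= c;
  pre_dist_one : forall x y, pre_dist x y 1 }.

Record distSpace := DistSpace {
  dist_pre :> preDistSpace;
  dist_closed : forall (x y : dist_pre) c,
    (forall e, 0 < e -> pre_dist x y (c + e)) -> pre_dist x y c }.

Definition dist_le (X : distSpace) (x y : X) (c : rat) : Prop := pre_dist x y c.

Section DistSpaceTheory.
Variable X : distSpace.
Implicit Types (x y z : X) (c e : rat).

Lemma dist_refl x : dist_le x x 0. Proof. exact: pre_dist_refl. Qed.
Lemma dist_sym x y c : dist_le x y c -> dist_le y x c. Proof. exact: pre_dist_sym. Qed.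
Lemma dist_trans x y z c e : dist_le x y c -> dist_le y z e -> dist_le x z (c + e).
Proof. exact: pre_dist_trans. Qed.
Lemma dist_mono x y c e : c <= e -> dist_le x y c -> dist_le x y e.
Proof. exact: pre_dist_mono. Qed.
Lemma dist_ge0 x y c : dist_le x y c -> 0 <= c. Proof. exact: pre_dist_ge0. Qed.
Lemma dist_one x y : dist_le x y 1. Proof. exact: pre_dist_one. Qed.

Lemma dist0l x y z c : dist_le x y 0 -> dist_le y z c -> dist_le x z c.
Proof. by move=> h k; rewrite -[c]add0r; exact: dist_trans h k. Qed.

Lemma dist0r x y z c : dist_le y z 0 -> dist_le x y c -> dist_le x z c.
Proof. by move=> h k; rewrite -[c]addr0; exact: dist_trans k h. Qed.

Lemma dist0_eq x y x' y' c : dist_le x x' 0 -> dist_le y y' 0 ->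
  dist_le x y c <-> dist_le x' y' c.
Proof.
move=> h k; split=> H.
  exact: (dist0l (dist_sym h) (dist0r k H)).
exact: (dist0l h (dist0r (dist_sym k) H)).
Qed.

End DistSpaceTheory.

Section Closure.
Variable P : preDistSpace.
Definition closure_dist (x y : P) c : Prop := forall e, 0 < e -> pre_dist x y (c + e).

Lemma closure_sub (x y : P) c : pre_dist x y c -> closure_dist x y c.
Proof. by move=> h e e0; apply: pre_dist_mono h; rewrite lerDl ltW. Qed.

Lemma closure_refl x : closure_dist x x 0. Proof. exact/closure_sub/pre_dist_refl. Qed.
Lemma closure_sym x y c : closure_dist x y c -> closure_dist y x c.
Proof. by move=> h e e0; apply/pre_dist_sym/h. Qed.
Lemma closure_trans x y z c e : closure_dist x y c -> closure_dist y z e -> closure_dist x z (c + e).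
Proof.
move=> h k d d0; have d2 : 0 < d / 2%:R by rewrite divr_gt0.
have -> : c + e + d = (c + d / 2%:R) + (e + d / 2%:R) by lra.
exact: pre_dist_trans (h _ d2) (k _ d2).
Qed.
Lemma closure_mono x y c e : c <= e -> closure_dist x y c -> closure_dist x y e.
Proof. by move=> ce h d d0; apply: pre_dist_mono (h _ d0); rewrite lerD2r. Qed.
Lemma closure_ge0 x y c : closure_dist x y c -> 0 <= c.
Proof.
move=> h; rewrite leNgt; apply/negP => c0.
have d0 : 0 < - c / 2%:R by lra.
have := pre_dist_ge0 (h _ d0); lra.
Qed.
Lemma closure_one x y : closure_dist x y 1. Proof. exact/closure_sub/pre_dist_one. Qed.

Definition closure_pre : preDistSpace := PreDistSpace closure_refl closure_sym closure_trans closure_mono closure_ge0 closure_one.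

Lemma closure_closed (x y : closure_pre) c :
  (forall e, 0 < e -> pre_dist x y (c + e)) -> pre_dist x y c.
Proof.
move=> h e e0; have d2 : 0 < e / 2%:R by rewrite divr_gt0.
have -> : c + e = c + e / 2%:R + e / 2%:R by lra.
exact: h.
Qed.

Definition closure_space : distSpace := DistSpace closure_closed.

Lemma dist_cl (x y : P) c : pre_dist x y c -> @dist_le closure_space x y c.
Proof. exact: closure_sub. Qed.

End Closure.

(** * Adjoining isometries to a distance space *)

Section Extension.
Variable X : distSpace.
Implicit Types (x y : X) (c e : rat).

(** A letter lists the pairs (a_k, b_k) of a partial map; the boolean of a
    letter in a word is [true] for the letter and [false] for its inverse.  The
    head of a word is its innermost letter, the first to act on a point. *)
Definition letter := seq (X * X).
Definition word := seq (letter * bool).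
Implicit Types (p q : letter) (s : bool) (v w : word).

(** The pair (a, b) as seen by a letter, or by its inverse: the letter sends
    [src] to [tgt]. *)
Definition src s (ab : X * X) : X := if s then ab.1 else ab.2.
Definition tgt s (ab : X * X) : X := if s then ab.2 else ab.1.

(** A letter is valid if it is a partial isometry; the other letters exist
    as well but can neither be crossed nor be exchanged with a valid one. *)
Definition valid p : Prop := forall k l ab ab',
  onth p k = Some ab -> onth p l = Some ab' ->
  forall c, dist_le ab.1 ab'.1 c <-> dist_le ab.2 ab'.2 c.

Definition subst_le p q c : Prop :=
  [/\ 0 <= c, size p = size q, valid p <-> valid q &
   forall k ab ab', onth p k = Some ab -> onth q k = Some ab' ->
     exists c1 c2, [/\ dist_le ab.1 ab'.1 c1, dist_le ab.2 ab'.2 c2 & c1 + c2 <= c]].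

Lemma subst_refl p : subst_le p p 0.
Proof.
split=> // k ab ab' -> [<-]; exists 0, 0.
by split; [exact: dist_refl|exact: dist_refl|rewrite addr0].
Qed.

Lemma subst_sym p q c : subst_le p q c -> subst_le q p c.
Proof.
case=> c0 sz [va vb] h; split=> // k ab ab' hq hp.
have [c1 [c2 [h1 h2 h3]]] := h _ _ _ hp hq.
by exists c1, c2; split=> //; exact: dist_sym.
Qed.

Lemma onth_size2 p q k ab : size p = size q -> onth p k = Some ab ->
  exists ab', onth q k = Some ab'.
Proof.
move=> sz h; have := onthTE p k; rewrite h /= => /esym; rewrite sz -onthTE.
by case: onth => // ab' _; exists ab'.
Qed.

Lemma subst_trans p q r c e : subst_le p q c -> subst_le q r e -> subst_le p r (c + e).
Proof.
case=> c0 sz v h [e0 sz' v' h']; split; [exact: addr_ge0|congruence|tauto|].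
move=> k ab ab' hp hr; have [ab'' hq] := onth_size2 sz hp.
have [c1 [c2 [h1 h2 h3]]] := h _ _ _ hp hq.
have [c3 [c4 [h4 h5 h6]]] := h' _ _ _ hq hr.
exists (c1 + c3), (c2 + c4); split; last by lra.
  exact: dist_trans h1 h4.
exact: dist_trans h2 h5.
Qed.

Lemma subst_st p q c s k ab : subst_le p q c -> onth p k = Some ab ->
  exists ab' c1 c2, [/\ onth q k = Some ab', dist_le (src s ab) (src s ab') c1,
    dist_le (tgt s ab) (tgt s ab') c2 & c1 + c2 <= c].
Proof.
case=> c0 sz v h hp; have [ab' hq] := onth_size2 sz hp.
have [c1 [c2 [h1 h2 h3]]] := h _ _ _ hp hq.
exists ab'; case: s; [exists c1, c2|exists c2, c1]; split=> //.
by rewrite addrC.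
Qed.

Lemma valid_st p s k l ab ab' c : valid p ->
  onth p k = Some ab -> onth p l = Some ab' ->
  dist_le (src s ab) (src s ab') c -> dist_le (tgt s ab) (tgt s ab') c.
Proof. by move=> v hk hl; have [h1 h2] := v _ _ _ _ hk hl c; case: s. Qed.

Lemma src_neg s ab : src (~~ s) ab = tgt s ab. Proof. by case: s. Qed.
Lemma tgt_neg s ab : tgt (~~ s) ab = src s ab. Proof. by case: s. Qed.

(** The largest distance on words over points for which valid letters do what
    their pairs say ([chain_glue]), letters act as invertible isometries and
    nearby letters are nearby as maps ([chain_subst]).  The words around the
    modified letters make these constraints invariant under left
    multiplication. *)
Inductive chain : word * X -> word * X -> rat -> Prop :=
| chain_dist v x y c : dist_le x y c -> chain (v, x) (v, y) c
| chain_glue p s v k ab : valid p -> onth p k = Some ab ->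
    chain ((p, s) :: v, src s ab) (v, tgt s ab) 0
| chain_cancel v1 p s v2 x :
    chain (v1 ++ (p, s) :: (p, ~~ s) :: v2, x) (v1 ++ v2, x) 0
| chain_subst v1 p q s v2 x c : subst_le p q c ->
    chain (v1 ++ (p, s) :: v2, x) (v1 ++ (q, s) :: v2, x) c
| chain_sym z z' c : chain z z' c -> chain z' z c
| chain_trans z z' z'' c e : chain z z' c -> chain z' z'' e -> chain z z'' (c + e)
| chain_mono z z' c e : c <= e -> chain z z' c -> chain z z' e
| chain_one z z' : chain z z' 1.

Lemma chain_refl z : chain z z 0.
Proof. by case: z => v x; apply/chain_dist/dist_refl. Qed.

Lemma chain_ge0 z z' c : chain z z' c -> 0 <= c.
Proof.
elim=> //; first by move=> v x y c' /dist_ge0.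
- by move=> v1 p q s v2 x c' [].
- by move=> z1 z2 z3 c1 c2 _ h1 _ h2; exact: addr_ge0.
- by move=> z1 z2 c1 c2 h _; lra.
Qed.

Definition iso_ext_pre : preDistSpace :=
  PreDistSpace chain_refl chain_sym chain_trans chain_mono chain_ge0 chain_one.
Definition iso_ext : distSpace := closure_space iso_ext_pre.

Definition to_ext (x : X) : iso_ext := ([::], x).

(** A cost at which a word applied to [x] can be brought to [y] by only
    destroying letters: the point either crosses the innermost letter, or two
    adjacent letters of opposite signs cancel after one is substituted for the
    other.  That letters never need to be created is the content of the lemmas
    up to [reduction_chain]. *)
Inductive reduction : word -> X -> X -> rat -> Prop :=
| reduction_one v x y c : 1 <= c -> reduction v x y c
| reduction_nil x y c : dist_le x y c -> reduction [::] x y c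
| reduction_cross p s v k ab x y d c e : valid p -> onth p k = Some ab ->
    dist_le x (src s ab) d -> reduction v (tgt s ab) y c -> d + c <= e ->
    reduction ((p, s) :: v) x y e
| reduction_cancel v1 p q s v2 x y d c e : subst_le p q d ->
    reduction (v1 ++ v2) x y c -> d + c <= e ->
    reduction (v1 ++ (p, s) :: (q, ~~ s) :: v2) x y e.

Lemma reduction_mono v x y c e : c <= e -> reduction v x y c -> reduction v x y e.
Proof.
move=> ce h; case: h ce => {v x y c}.
- by move=> v x y c c1 ce; apply: reduction_one; lra.
- by move=> x y c h ce; apply: reduction_nil; exact: dist_mono h.
- move=> p s v k ab x y d c f vp hk hd hs le ce.
  by apply: (reduction_cross vp hk hd hs); lra.
- move=> v1 p q s v2 x y d c f hs h le ce.
  by apply: (reduction_cancel s hs h); lra.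
Qed.

Lemma reduction_ge0 v x y c : reduction v x y c -> 0 <= c.
Proof.
elim=> {v x y c} //; first by move=> v x y c; lra.
- by move=> x y c /dist_ge0.
- by move=> p s v k ab x y d c e _ _ /dist_ge0 d0 _ c0; lra.
- by move=> v1 p q s v2 x y d c e [d0 _ _ _] _ c0; lra.
Qed.

Lemma reduction_dist v x x' y c e :
  reduction v x y c -> dist_le x x' e -> reduction v x' y (c + e).
Proof.
move=> h; elim: h x' e => {v x y c}.
- by move=> v x y c c1 x' e /dist_ge0 e0; apply: reduction_one; lra.
- move=> x y c h x' e hx; apply: reduction_nil; rewrite addrC.
  exact: dist_trans (dist_sym hx) h.
- move=> p s v k ab x y d c f vp hk hd hs _ le x' e hx.
  apply: (reduction_cross vp hk _ hs); first exact: dist_trans (dist_sym hx) hd.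
  by lra.
- move=> v1 p q s v2 x y d c f hs h IH le x' e hx.
  by apply: (reduction_cancel s hs (IH _ _ hx)); lra.
Qed.

Lemma cat_eq_cat (T : Type) (a b c d : seq T) : a ++ b = c ++ d ->
  (exists m, c = a ++ m /\ b = m ++ d) \/ (exists m, a = c ++ m /\ d = m ++ b).
Proof.
elim: a c => [|t a IH] [|u c] //=.
- by move=> ->; left; exists [::].
- by move=> ->; left; exists (u :: c).
- by move=> <-; right; exists (t :: a).
- case=> -> /IH [[m [-> ->]]|[m [-> ->]]]; [left|right]; by exists m.
Qed.

(** A letter is destroyed either by a crossing, and then the two
    displacements of the entry that is crossed pay for the substitution, or by a
    cancellation, and then substitutions compose. *)
Lemma reduction_subst v1 p q s v2 x y c e :
  reduction (v1 ++ (p, s) :: v2) x y c -> subst_le p q e ->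
  reduction (v1 ++ (q, s) :: v2) x y (c + e).
Proof.
move Ev : (_ ++ _) => v h; elim: h v1 v2 Ev => {v x y c}.
- by move=> v x y c c1 v1 v2 _ [e0 _ _ _]; apply: reduction_one; lra.
- by move=> x y c h [].
- move=> p0 s0 v k ab x y d c f vp hk hd hs IH le [|l v1] v2 /= [].
    move=> ? ? ? sub; subst p0 s0 v.
    have [ab' [c1 [c2 [hq h1 h2 h3]]]] := subst_st s sub hk.
    have [_ _ [vq _] _] := sub.
    apply: (reduction_cross (vq vp) hq (dist_trans hd h1) (reduction_dist hs h2)).
    by lra.
  move=> -> Ev sub; apply: (reduction_cross vp hk hd (IH _ _ Ev sub)); lra.
- move=> u1 p0 q0 s0 u2 x y d c f hs h IH le v1 v2 Ev sub.
  have [[m [E1 E2]]|[m [E1 E2]]] := cat_eq_cat Ev.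
    case: m E1 E2 => [|l m] /= E1 [].
      rewrite cats0 in E1 => ? ? ?; subst u1 p0 s0 v2.
      apply: (reduction_cancel (d := d + e) s _ h); last by lra.
      by rewrite addrC; exact: subst_trans (subst_sym sub) hs.
    move=> ? ?; subst l v2 u1.
    rewrite -[v1 ++ (q, s) :: _]/(v1 ++ ((q, s) :: m) ++ _) catA.
    apply: (reduction_cancel s0 hs (c := c + e)); last by lra.
    by rewrite -catA /=; apply: IH => //; rewrite -catA.
  case: m E1 E2 => [|l m] /= E1 [].
    rewrite cats0 in E1 => ? ? ?; subst v1 p0 s0 v2.
    apply: (reduction_cancel (d := d + e) s _ h); last by lra.
    by rewrite addrC; exact: subst_trans (subst_sym sub) hs.
  move=> ?; subst l; case: m E1 => [|l m] /= E1 [].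
    move=> ? ? ?; subst p s v2 v1.
    rewrite -catA /=.
    by apply: (reduction_cancel (d := d + e) s0 _ h); [exact: subst_trans hs sub|lra].
  move=> ? ?; subst l u2 v1.
  rewrite -catA /=.
  apply: (reduction_cancel s0 hs (c := c + e)); last by lra.
  by rewrite catA; apply: IH => //; rewrite -catA.
Qed.

(** If the letter is crossed at another pair, validity says that both sides of
    the letter are equally far apart.  If it is cancelled by a letter [q], the
    point crosses [q] instead: this is where both displacements, on the side of
    the sources and on the side of the targets, are needed. *)
Lemma reduction_glue p s v k ab y c : valid p -> onth p k = Some ab ->
  reduction ((p, s) :: v) (src s ab) y c -> reduction v (tgt s ab) y c.
Proof.
move=> vp hk; move Eu : (_ :: _) => u; move Ex : (src s ab) => x h.
elim: h v Eu Ex => {u x y c}.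
- by move=> u x y c c1 v _ _; exact: reduction_one.
- by [].
- move=> p0 s0 v0 l ab0 x y d c e vp0 hl hd hs _ le v [? ? ?] Ex.
  subst p0 s0 v0 x.
  have hd' := dist_sym (valid_st vp hk hl hd).
  by apply: reduction_mono (reduction_dist hs hd'); rewrite addrC.
- move=> [|l v1] p0 q s0 v2 x y d c e hs h IH le v /= [].
    move=> ? ? ? Ex; subst p0 s0 v x.
    have [ab' [c1 [c2 [hq h1 h2 h3]]]] := subst_st s hs hk.
    have [_ _ [vq _] _] := hs.
    apply: (reduction_cross (s := ~~ s) (vq vp) hq (d := c2) (c := c + c1)).
    + by rewrite src_neg.
    + by rewrite tgt_neg; exact: reduction_dist h h1.
    + by lra.
  move=> ? ? Ex; subst l v.
  by apply: (reduction_cancel s0 hs (IH _ _ Ex) le).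
Qed.

(** The two letters may be destroyed together, or by crossing both, or the
    outer one may be cancelled against a third letter, for which the remaining
    one is then substituted. *)
Lemma reduction_uncancel v1 p s v2 x y c :
  reduction (v1 ++ (p, s) :: (p, ~~ s) :: v2) x y c -> reduction (v1 ++ v2) x y c.
Proof.
move Ev : (_ ++ _) => v h; elim: h v1 v2 Ev => {v x y c}.
- by move=> v x y c c1 v1 v2 _; exact: reduction_one.
- by move=> x y c h [].
- move=> p0 s0 v k ab x y d c f vp hk hd hs IH le [|l v1] v2 /= [].
    move=> ? ? ?; subst p0 s0 v.
    have h : reduction v2 (src s ab) y c.
      rewrite -tgt_neg; apply: (reduction_glue (s := ~~ s) vp hk).
      by rewrite src_neg.
    by apply: reduction_mono (reduction_dist h (dist_sym hd)); rewrite addrC.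
  by move=> -> Ev; apply: (reduction_cross vp hk hd (IH _ _ Ev) le).
- move=> u1 p0 q0 s0 u2 x y d c f hs h IH le v1 v2 Ev.
  have [d0 _ _ _] := hs.
  have cf : c <= f by lra.
  have [[m [E1 E2]]|[m [E1 E2]]] := cat_eq_cat Ev.
    case: m E1 E2 => [|l m] /= E1 [].
      rewrite cats0 in E1 => ? ? ? ? ?; subst u1 p0 s0 q0 u2.
      exact: reduction_mono h.
    move=> ?; subst l; case: m E1 => [|l m] /= E1 [].
      move=> ? ? ?; subst p0 s0 v2 u1; rewrite -catA /= negbK in h *.
      by apply: reduction_mono (reduction_subst h hs); lra.
    move=> ? ?; subst l v2 u1; rewrite catA.
    apply: (reduction_cancel s0 hs (c := c)) => //.
    by rewrite -catA; apply: IH; rewrite -catA.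
  case: m E1 E2 => [|l m] /= E1 [].
    rewrite cats0 in E1 => ? ? ? ? ?; subst v1 p0 s0 q0 u2.
    exact: reduction_mono h.
  move=> ?; subst l; case: m E1 => [|l m] /= E1 [].
    move=> ? ? ?; subst p s u2 v1; rewrite -catA /= negbK in h *.
    by apply: reduction_mono (reduction_subst h (subst_sym hs)); lra.
  move=> ? ?; subst l u2 v1; rewrite -catA /=.
  apply: (reduction_cancel s0 hs (c := c)) => //.
  by rewrite catA; apply: IH; rewrite -catA.
Qed.

(** The induction goes through symmetry because both directions are carried
    along. *)
Lemma reduction_chain (z z' : word * X) c : chain z z' c -> forall y e,
  (reduction z.1 z.2 y e -> reduction z'.1 z'.2 y (e + c)) /\
  (reduction z'.1 z'.2 y e -> reduction z.1 z.2 y (e + c)).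
Proof.
elim=> {z z' c} /=.
- move=> v x x' c h y e; split=> H; first exact: reduction_dist h.
  exact: reduction_dist (dist_sym h).
- move=> p s v k ab vp hk y e; rewrite addr0; split; first exact: (reduction_glue vp hk).
  by move=> h; apply: (reduction_cross vp hk (dist_refl _) h); rewrite add0r.
- move=> v1 p s v2 x y e; rewrite addr0; split; first exact: reduction_uncancel.
  by move=> h; apply: (reduction_cancel _ (subst_refl p) h); rewrite add0r.
- move=> v1 p q s v2 x c h y e; split=> H; first exact: reduction_subst h.
  exact: reduction_subst (subst_sym h).
- by move=> z z' c _ IH y e; have [] := IH y e.
- move=> z1 z2 z3 c e _ IH1 _ IH2 y f; split=> H.
    by rewrite addrA; apply IH2; apply IH1.
  by rewrite (addrC c) addrA; apply IH1; apply IH2.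
- move=> z1 z2 c e ce _ IH y f; split=> H.
    by apply: reduction_mono (proj1 (IH y f) H); lra.
  by apply: reduction_mono (proj2 (IH y f) H); lra.
- by move=> z1 z2 y e; split=> /= H; apply: reduction_one;
     have := reduction_ge0 H; lra.
Qed.

(** The empty word reduces to [y] only inside [X], so a chain between two
    points of [X] costs at least their distance. *)
Lemma to_ext_isometry x y c : @dist_le iso_ext (to_ext x) (to_ext y) c <-> dist_le x y c.
Proof.
split; last by move=> h; apply/dist_cl/chain_dist.
move=> h; apply: dist_closed => e e0.
have /= /(reduction_chain)/(_ y 0)[_] := h _ e0; clear h.
move=> /(_ (reduction_nil (dist_refl y))) /=; rewrite add0r.
move: (c + e) => f; move Ev: [::] => v H; case: H Ev => //.
by move=> {}v {}x {}y {}f f1 _; exact: dist_mono f1 (dist_one _ _).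
by move=> [].
Qed.

(** Left multiplication by a letter and by its inverse: the outermost letter is
    the last of the word. *)
Definition append (p : letter) (z : iso_ext) : iso_ext := (rcons z.1 (p, true), z.2).
Definition unappend (p : letter) (z : iso_ext) : iso_ext := (rcons z.1 (p, false), z.2).

Lemma chain_rcons l (z z' : word * X) c : chain z z' c ->
  chain (rcons z.1 l, z.2) (rcons z'.1 l, z'.2) c.
Proof.
elim=> {z z' c} /=.
- by move=> v x y c h; exact: chain_dist.
- by move=> p s v k ab vp hk; exact: (chain_glue s (rcons v l) vp hk).
- by move=> v1 p s v2 x; rewrite !rcons_cat; exact: chain_cancel.
- by move=> v1 p q s v2 x c h; rewrite !rcons_cat; exact: chain_subst.
- by move=> z z' c _; exact: chain_sym.
- by move=> z z' z'' c e _ h _; exact: chain_trans.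
- by move=> z z' c e ce _; exact: chain_mono.
- by move=> z z'; exact: chain_one.
Qed.

Lemma append_mul s p (z : iso_ext) :
  @dist_le iso_ext (rcons (rcons z.1 (p, s)) (p, ~~ s), z.2) z 0.
Proof.
apply: dist_cl; case: z => v x /=.
by rewrite -!cats1 -catA /= -{2}[v]cats0; exact: chain_cancel.
Qed.

Lemma rcons_dist l (z z' : iso_ext) c : @dist_le iso_ext z z' c ->
  @dist_le iso_ext (rcons z.1 l, z.2) (rcons z'.1 l, z'.2) c.
Proof. by move=> h e e0; exact: (chain_rcons l (h e e0)). Qed.

Lemma append_dist p (z z' : iso_ext) c :
  dist_le (append p z) (append p z') c <-> dist_le z z' c.
Proof.
split; last exact: rcons_dist.
move=> /(rcons_dist (p, false)) /=.
by move/dist0_eq; apply; exact: (append_mul true).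
Qed.

Lemma append_surj p (z : iso_ext) : dist_le (append p (unappend p z)) z 0.
Proof. exact: (append_mul false). Qed.

Lemma append_glue p k ab : valid p -> onth p k = Some ab ->
  dist_le (append p (to_ext ab.1)) (to_ext ab.2) 0.
Proof. by move=> vp hk; apply/dist_cl/(chain_glue true _ vp hk). Qed.

End Extension.

(** * Functoriality in isometries *)

Definition isometry (X Y : distSpace) (f : X -> Y) : Prop :=
  forall x y c, dist_le (f x) (f y) c <-> dist_le x y c.

(** Surjectivity up to distance 0, as the spaces are only pseudo-metric. *)
Definition automorphism (X : distSpace) (f : X -> X) : Prop :=
  isometry f /\ forall y, exists x, dist_le (f x) y 0.

Section Functor.
Variable X : distSpace.
Implicit Types (f g : X -> X) (p q : letter X) (v w : word X).

Definition map_letter f p : letter X := [seq (f ab.1, f ab.2) | ab <- p].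
Definition map_ext f (z : iso_ext X) : iso_ext X :=
  ([seq (map_letter f l.1, l.2) | l <- z.1], f z.2).

Lemma onth_map_letter f p k :
  onth (map_letter f p) k = omap (fun ab => (f ab.1, f ab.2)) (onth p k).
Proof. by rewrite onth_map. Qed.

Lemma src_map f s ab : src s (f ab.1, f ab.2) = f (src s ab).
Proof. by case: s. Qed.
Lemma tgt_map f s ab : tgt s (f ab.1, f ab.2) = f (tgt s ab).
Proof. by case: s. Qed.

Lemma valid_map f p : isometry f -> valid (map_letter f p) <-> valid p.
Proof.
move=> isof; split=> vp k l ab ab'.
  move=> hk hl c.
  have := vp k l (f ab.1, f ab.2) (f ab'.1, f ab'.2).
  rewrite !onth_map_letter hk hl /= => /(_ erefl erefl c) [h1 h2].
  have [h3 h4] := isof ab.1 ab'.1 c.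
  have [h5 h6] := isof ab.2 ab'.2 c.
  by split=> ?; [apply/h5/h1/h4|apply/h3/h2/h6].
rewrite !onth_map_letter; case hk: (onth p k) => [ab0|] //= -[<-].
case hl: (onth p l) => [ab0'|] //= -[<-] c /=.
have [h1 h2] := vp _ _ _ _ hk hl c.
have [h3 h4] := isof ab0.1 ab0'.1 c.
have [h5 h6] := isof ab0.2 ab0'.2 c.
by split=> ?; [apply/h6/h1/h3|apply/h4/h2/h5].
Qed.

Lemma subst_map f p q c : isometry f -> subst_le p q c ->
  subst_le (map_letter f p) (map_letter f q) c.
Proof.
move=> isof [c0 sz vpq h]; split=> //; first by rewrite !size_map.
  have := valid_map p isof; have := valid_map q isof; tauto.
move=> k ab ab'; rewrite !onth_map_letter.
case hk: (onth p k) => [ab0|] //= -[<-].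
case hl: (onth q k) => [ab0'|] //= -[<-].
have [c1 [c2 [h1 h2 h3]]] := h _ _ _ hk hl.
by exists c1, c2; split=> //=; apply/isof.
Qed.

Lemma map_ext_chain f (z z' : iso_ext X) c : isometry f -> chain z z' c ->
  chain (map_ext f z) (map_ext f z') c.
Proof.
move=> isof; elim=> {z z' c} /=.
- by move=> v x y c h; apply/chain_dist/isof.
- move=> p s v k ab vp hk; rewrite /map_ext /= -src_map -tgt_map.
  apply: (@chain_glue _ _ _ _ k); first exact/valid_map.
  by rewrite onth_map_letter hk.
- by move=> v1 p s v2 x; rewrite /map_ext /= !map_cat /=; exact: chain_cancel.
- move=> v1 p q s v2 x c h; rewrite /map_ext /= !map_cat /=.
  by apply: chain_subst; exact: subst_map.
- by move=> z z' c _; exact: chain_sym.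
- by move=> z z' z'' c e _ h _; exact: chain_trans.
- by move=> z z' c e ce _; exact: chain_mono.
- by move=> z z'; exact: chain_one.
Qed.

Lemma map_ext_dist1 f (z z' : iso_ext X) c : isometry f -> dist_le z z' c ->
  dist_le (map_ext f z) (map_ext f z') c.
Proof. by move=> isof h e e0; apply: map_ext_chain isof (h e e0). Qed.

Lemma subst_near p q : size p = size q ->
  (forall k ab ab', onth p k = Some ab -> onth q k = Some ab' ->
     dist_le ab.1 ab'.1 0 /\ dist_le ab.2 ab'.2 0) -> subst_le p q 0.
Proof.
move=> sz h; split=> //; last first.
  by move=> k ab ab' hp hq; exists 0, 0; have [] := h _ _ _ hp hq.
suff H p' q' : size p' = size q' -> (forall k ab ab', onth p' k = Some ab ->
    onth q' k = Some ab' -> dist_le ab.1 ab'.1 0 /\ dist_le ab.2 ab'.2 0) ->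
    valid p' -> valid q'.
  split; first exact: H.
  apply: H => // k ab ab' hq hp; have [h1 h2] := h _ _ _ hp hq.
  by split; exact: dist_sym.
move=> {}sz {}h vp k l ab ab' hk hl c.
have [ab1 hk1] := onth_size2 (esym sz) hk.
have [ab1' hl1] := onth_size2 (esym sz) hl.
have [h1 h2] := h _ _ _ hk1 hk; have [h3 h4] := h _ _ _ hl1 hl.
have E1 := dist0_eq c h1 h3; have E2 := dist0_eq c h2 h4.
by have := vp _ _ _ _ hk1 hl1 c; tauto.
Qed.

Lemma map_ext_id f (z : iso_ext X) : (forall x, dist_le (f x) x 0) ->
  dist_le (map_ext f z) z 0.
Proof.
move=> hf; apply: dist_cl; case: z => v x.
apply: (@chain_mono _ _ _ (0 + 0)) => //.
apply: (@chain_trans _ _ (v, f x)); last exact: chain_dist.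
rewrite /map_ext /= -[v in chain _ (v, _)]cat0s -[X in chain (X, _)]cat0s.
elim: v (@nil (letter X * bool)) => [|[p s] v IH] w /=; first exact: chain_refl.
apply: (@chain_mono _ _ _ (0 + 0)) => //.
apply: (@chain_trans _ _ (w ++ (p, s) :: [seq (map_letter f l.1, l.2) | l <- v], f x)).
  apply/chain_subst/subst_near; first by rewrite size_map.
  move=> k ab ab'; rewrite onth_map_letter => + hk; rewrite hk /= => -[<-] /=.
  by split.
by rewrite -!cat_rcons; exact: IH.
Qed.

Lemma map_ext_comp f g (z : iso_ext X) :
  map_ext (fun x => f (g x)) z = map_ext f (map_ext g z).
Proof.
rewrite /map_ext /= -map_comp; congr (_, _); apply: eq_map => -[p s] /=.
by rewrite /map_letter -map_comp.
Qed.

Lemma auto_inv f : automorphism f -> exists g, [/\ isometry g,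
  forall x, dist_le (f (g x)) x 0 & forall x, dist_le (g (f x)) x 0].
Proof.
move=> [isof sf]; have [g hg] := choice sf; exists g.
have isog : isometry g.
  move=> x y c; have h := isof (g x) (g y) c.
  by have := dist0_eq c (hg x) (hg y); tauto.
by split=> // x; apply/isof.
Qed.

(** Applying the extension of a quasi-inverse shows that no distance
    decreases. *)
Lemma map_ext_auto f : automorphism f -> automorphism (map_ext f).
Proof.
move=> af; have [g [isog fg gf]] := auto_inv af; have [isof _] := af.
have gfz z := map_ext_id z gf; have fgz z := map_ext_id z fg.
split; last by move=> z; exists (map_ext g z); rewrite -map_ext_comp.
move=> z z' c; split; last exact: map_ext_dist1.
move=> /(map_ext_dist1 isog); rewrite -!map_ext_comp.
by move/(dist0_eq c (gfz z) (gfz z')).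
Qed.

End Functor.

(** * The limit of the iterated extensions *)

Section SmallDisplacement.
Variable X : distSpace.

Definition near_id (f : X -> X) (A : seq X) (d : rat) : Prop :=
  forall x, List.In x A -> dist_le (f x) x d.

Fixpoint letter_supp (p : letter X) : seq X :=
  if p is ab :: p' then [:: ab.1, ab.2 & letter_supp p'] else [::].
Fixpoint word_supp (v : word X) : seq X :=
  if v is l :: v' then letter_supp l.1 ++ word_supp v' else [::].

Lemma subst_map_near f p d : isometry f -> 0 <= d ->
  near_id f (letter_supp p) d -> subst_le (map_letter f p) p (d + d).
Proof.
move=> isof d0 hd; split; first by lra.
- by rewrite size_map.
- exact: valid_map.
move=> k ab ab'; rewrite onth_map_letter => + hk; rewrite hk /= => -[<-] /=.
exists d, d.
suff [h1 h2] : List.In ab'.1 (letter_supp p) /\ List.In ab'.2 (letter_supp p).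
  by split=> //; exact: hd.
elim: p k hk {hd} => [|ab0 p IH] [|k] //=.
  by case=> ->; split; [left|right; left].
by move=> /IH[h1 h2]; split; right; right.
Qed.

(** Exchanging each of the letters of a word, and its point, for their images
    costs little if the finitely many points that occur are hardly moved. *)
Lemma small_map_ext (z : iso_ext X) e : 0 < e ->
  exists A d, 0 < d /\
    forall f, isometry f -> near_id f A d -> dist_le (map_ext f z) z e.
Proof.
case: z => v x e0; exists (x :: word_supp v).
pose n := ((size v).*2.+1)%:R : rat.
have n0 : 0 < n by rewrite ltr0n.
exists (e / n); split; first by rewrite divr_gt0.
move=> f isof hf; apply: dist_cl; set d := e / n in hf.
have d0 : 0 < d by rewrite divr_gt0.
have Ed : e = (size v)%:R * (d + d) + d.
  have -> : e = n * d by rewrite /d mulrCA divff ?mulr1 // gt_eqF.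
  rewrite /n -[(_.*2.+1)%:R]natr1 -addnn natrD; ring.
rewrite Ed; clearbody d; clear Ed n n0 e0 e.
apply: (@chain_trans _ _ (v, f x)); last first.
  by apply: chain_dist; apply: hf; left.
have {}hf : near_id f (word_supp v) d by move=> y hy; apply: hf; right.
rewrite /map_ext /= -[v in chain _ (v, _)]cat0s -[X in chain (X, _)]cat0s.
elim: v (@nil (letter X * bool)) hf {d0} (ltW d0) => [|[p s] v IH] w hf d0 /=.
  by rewrite mul0r; exact: chain_refl.
have -> : (size v).+1%:R * (d + d) = (d + d) + (size v)%:R * (d + d).
  by rewrite -natr1; ring.
apply: (@chain_trans _ _ (w ++ (p, s) :: [seq (map_letter f l.1, l.2) | l <- v], f x)).
  by apply/chain_subst/subst_map_near => // y hy; apply/hf/List.in_or_app; left.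
by rewrite -!cat_rcons; apply: IH => // y hy; apply/hf/List.in_or_app; right.
Qed.

End SmallDisplacement.

(** Dependent recursion starting at a stage [N] other than 0; at this stage
    the value has to be cast. *)
Lemma extend_seq (A : nat -> Type) (step : forall n, A n -> A n.+1)
    (dflt : forall n, A n) N (a : A N) :
  exists s : forall n, A n, s N = a /\
    forall n, (N <= n)%N -> s n.+1 = step n (s n).
Proof.
pose castA n (e : N = n) (b : A N) : A n := eq_rect N A b n e.
pose s := fix s n : A n := match @eqP _ N n return A n with
  | ReflectT e => castA _ e a
  | ReflectF _ => match n return A n with 0 => dflt 0 | n'.+1 => step n' (s n') end
  end.
have sE n : s n = match @eqP _ N n return A n with
    | ReflectT e => castA _ e a
    | ReflectF _ =>
      match n return A n with 0 => dflt 0 | n'.+1 => step n' (s n') end end.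
  by case: n.
exists s; split.
  by rewrite sE; case: eqP => // e; rewrite /castA eq_axiomK.
move=> n Nn /=; case: eqP => // e; exfalso.
by move: Nn; rewrite e ltnn.
Qed.

Section Limit.
Variable X0 : distSpace.

Fixpoint tower n : distSpace := if n is n'.+1 then iso_ext (tower n') else X0.
Fixpoint tower_lift n (x : X0) : tower n :=
  match n return tower n with 0 => x | n'.+1 => to_ext (tower_lift n' x) end.

Definition coherent (s : forall n, tower n) N : Prop :=
  forall n, (N <= n)%N -> s n.+1 = to_ext (s n).

(** The colimit, as the sequences which eventually follow the embeddings: the
    distance of two of them is eventually constant. *)
Definition lim_car : Type := {s : forall n, tower n | exists N, coherent s N}.
Definition stage (s : lim_car) n : tower n := sval s n.

Lemma coherent_le s N M : (N <= M)%N -> coherent s N -> coherent s M.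
Proof. by move=> NM h n Mn; apply: h; exact: leq_trans Mn. Qed.

Lemma lim_coherent2 (s t : lim_car) :
  exists N, coherent (stage s) N /\ coherent (stage t) N.
Proof.
case: s t => [s [N hs]] [t [M ht]]; exists (maxn N M); split.
  exact: coherent_le (leq_maxl _ _) hs.
exact: coherent_le (leq_maxr _ _) ht.
Qed.

Lemma coherent_dist s t N n c : coherent s N -> coherent t N -> (N <= n)%N ->
  dist_le (s n) (t n) c <-> dist_le (s N) (t N) c.
Proof.
move=> hs ht /subnKC <-; elim: (n - N)%N => [|k IH]; first by rewrite addn0.
rewrite addnS hs ?leq_addr // ht ?leq_addr //.
by have := to_ext_isometry (s (N + k)%N) (t (N + k)%N) c; tauto.
Qed.

Definition lim_dist (s t : lim_car) c : Prop :=
  exists N, forall n, (N <= n)%N -> dist_le (stage s n) (stage t n) c.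

Lemma lim_distE s t N c : coherent (stage s) N -> coherent (stage t) N ->
  lim_dist s t c <-> dist_le (stage s N) (stage t N) c.
Proof.
move=> hs ht; split.
  move=> [M h]; apply/(coherent_dist c hs ht (leq_maxl N M))/h.
  exact: leq_maxr.
by move=> h; exists N => n Nn; apply/(coherent_dist c hs ht Nn).
Qed.

Lemma lim_refl s : lim_dist s s 0.
Proof. by exists 0%N => n _; exact: dist_refl. Qed.
Lemma lim_sym s t c : lim_dist s t c -> lim_dist t s c.
Proof. by move=> [N h]; exists N => n /h; exact: dist_sym. Qed.
Lemma lim_trans s t u c e : lim_dist s t c -> lim_dist t u e -> lim_dist s u (c + e).
Proof.
move=> [N h] [M k]; exists (maxn N M) => n; rewrite geq_max => /andP[/h + /k].
exact: dist_trans.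
Qed.
Lemma lim_mono s t c e : c <= e -> lim_dist s t c -> lim_dist s t e.
Proof. by move=> ce [N h]; exists N => n /h; exact: dist_mono. Qed.
Lemma lim_ge0 s t c : lim_dist s t c -> 0 <= c.
Proof. by move=> [N h]; apply: dist_ge0 (h N _). Qed.
Lemma lim_one s t : lim_dist s t 1.
Proof. by exists 0%N => n _; exact: dist_one. Qed.
Definition lim_pre : preDistSpace :=
  PreDistSpace lim_refl lim_sym lim_trans lim_mono lim_ge0 lim_one.
Lemma lim_closed (s t : lim_pre) c :
  (forall e, 0 < e -> pre_dist s t (c + e)) -> pre_dist s t c.
Proof.
move=> h; have [N [hs ht]] := lim_coherent2 s t.
apply/(lim_distE c hs ht); apply: dist_closed => e e0.
exact/(lim_distE _ hs ht)/h.
Qed.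
Definition tower_lim : distSpace := DistSpace lim_closed.

Lemma tower_lift_coherent x : coherent (tower_lift^~ x) 0. Proof. by []. Qed.
Definition to_tower_lim (x : X0) : tower_lim := exist _ (tower_lift^~ x) (ex_intro _ 0%N (tower_lift_coherent x)).

Lemma to_tower_lim_isometry : isometry to_tower_lim.
Proof. by move=> x y c; exact: (@lim_distE (to_tower_lim x) (to_tower_lim y) 0). Qed.

Definition coherent_map (f : forall n, tower n -> tower n) N : Prop :=
  forall n, (N <= n)%N -> f n.+1 = map_ext (f n).

Lemma map_lim_proof f (N : nat) (s : tower_lim) : coherent_map f N ->
  exists M, coherent (fun n => f n (stage s n)) M.
Proof.
case: s => s [M hs] hf; exists (maxn N M) => n; rewrite geq_max => /andP[Nn Mn].
by rewrite /stage /= hf // hs.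
Qed.

Definition map_lim f N (hf : coherent_map f N) (s : tower_lim) : tower_lim :=
  exist _ (fun n => f n (stage s n)) (map_lim_proof s hf).

Lemma coherent_map_auto f N n : coherent_map f N -> automorphism (f N) -> (N <= n)%N -> automorphism (f n).
Proof.
move=> hf aN /subnKC <-; elim: (n - N)%N => [|k IH]; first by rewrite addn0.
by rewrite addnS hf ?leq_addr //; exact: map_ext_auto.
Qed.

(** The stages below [N] are filled by those of a given point [t], since the
    base could be empty. *)
Lemma from_stage (t : tower_lim) N (x : tower N) :
  exists s : tower_lim, coherent (stage s) N /\ stage s N = x.
Proof.
have [s [sN hs]] := extend_seq (fun n => @to_ext (tower n)) (stage t) x.
by exists (exist _ s (ex_intro _ N hs)).
Qed.

Lemma map_lim_auto f N (hf : coherent_map f N) : automorphism (f N) -> automorphism (map_lim hf).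
Proof.
move=> aN; split.
  move=> s t c; have [M [hs ht]] := lim_coherent2 s t.
  have NM := leq_maxl N M; have MM := leq_maxr N M.
  have cs := coherent_le MM hs; have ct := coherent_le MM ht.
  have := lim_distE c cs ct.
  have := @lim_distE (map_lim hf s) (map_lim hf t) (maxn N M) c.
  have [isof _] := coherent_map_auto hf aN NM.
  have := isof (stage s (maxn N M)) (stage t (maxn N M)) c.
  move=> h1 h2 h3; have {}h2 := h2 _ _.
  have c1 : coherent (stage (map_lim hf s)) (maxn N M).
    move=> n Kn; rewrite /= hf ?(leq_trans NM) //.
    by rewrite cs.
  have c2 : coherent (stage (map_lim hf t)) (maxn N M).
    move=> n Kn; rewrite /= hf ?(leq_trans NM) //.
    by rewrite ct.
  by have := h2 c1 c2; rewrite /= in h1 *; tauto.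
move=> t; case: (t) => t' [M ht]; set K := maxn N M.
have NK : (N <= K)%N := leq_maxl _ _; have MK : (M <= K)%N := leq_maxr _ _.
have [_ sf] := coherent_map_auto hf aN NK.
have [x hx] := sf (t' K); have [s [cs sK]] := from_stage t x.
exists s; exists K => n Kn.
have := @coherent_dist (stage (map_lim hf s)) t' K n 0.
move=> h; apply h => //.
- move=> m Km; rewrite /= hf ?(leq_trans NK) //.
  by rewrite cs.
- exact: coherent_le ht.
- by rewrite /= sK.
Qed.

Lemma lim_coherent_letter (p : letter tower_lim) : exists N, forall k ab, onth p k = Some ab ->
  coherent (stage ab.1) N /\ coherent (stage ab.2) N.
Proof.
elim: p => [|[a b] p [N IH]]; first by exists 0%N => -[].
have [M [ha hb]] := lim_coherent2 a b; exists (maxn N M) => -[|k] ab /=.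
  by case=> <-; split; [exact: coherent_le (leq_maxr _ _) ha|
                        exact: coherent_le (leq_maxr _ _) hb].
move=> /IH [h1 h2]; split; exact: coherent_le (leq_maxl _ _) _.
Qed.

(** All the points involved live at some stage [N]; the letter adjoined at
    stage [N.+1] extends the partial isometry, and it acts on the later stages
    by functoriality. *)
Theorem lim_homogeneous (p : letter tower_lim) : valid p ->
  exists2 f : tower_lim -> tower_lim, automorphism f &
    forall k ab, onth p k = Some ab -> dist_le (f ab.1) ab.2 0.
Proof.
move=> vp; have [N hN] := lim_coherent_letter p.
pose q : letter (tower N) := [seq (stage ab.1 N, stage ab.2 N) | ab <- p].
have hq k ab : onth p k = Some ab -> onth q k = Some (stage ab.1 N, stage ab.2 N).
  by move=> hk; rewrite onth_map hk.
have vq : valid q.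
  move=> k l ab ab'; rewrite !onth_map.
  case hk: (onth p k) => [ab0|] //= -[<-].
  case hl: (onth p l) => [ab0'|] //= -[<-] c /=.
  have [h1 h2] := hN _ _ hk; have [h3 h4] := hN _ _ hl.
  have := vp _ _ _ _ hk hl c.
  have := lim_distE c h1 h3; have := lim_distE c h2 h4.
  by rewrite /dist_le /=; tauto.
have [f [fN hf]] := extend_seq (A := fun n => tower n -> tower n)
  (fun n => @map_ext (tower n)) (fun n => id) (@append (tower N) q : tower N.+1 -> tower N.+1).
have af : automorphism (f N.+1).
  rewrite fN; split; first exact: append_dist.
  by move=> z; exists (unappend q z); exact: append_surj.
exists (map_lim hf); first exact: map_lim_auto.
move=> k ab hk; have [h1 h2] := hN _ _ hk.
exists N.+1 => n Nn.
have := @coherent_dist (stage (map_lim hf ab.1)) (stage ab.2) N.+1 n 0.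
move=> h; apply h => //.
- move=> m Nm; rewrite /= hf // h1 //; exact: ltnW.
- by move=> m Nm; rewrite h2 //; exact: ltnW.
rewrite /= fN h1 // h2 //.
exact: append_glue vq (hq _ _ hk).
Qed.

Fixpoint tower_map (f : X0 -> X0) n : tower n -> tower n :=
  match n return tower n -> tower n with 0 => f | n'.+1 => map_ext (tower_map f (n := n')) end.

Lemma tower_map_coherent f : coherent_map (@tower_map f) 0. Proof. by []. Qed.

Definition lim_map f : tower_lim -> tower_lim := map_lim (@tower_map_coherent f).

Lemma lim_map_auto f : automorphism f -> automorphism (lim_map f).
Proof. by move=> af; exact: map_lim_auto. Qed.

Lemma lim_eq (s t : tower_lim) : (forall n, stage s n = stage t n) -> s = t.
Proof.
case: s t => [s hs] [t ht] h; apply: eq_exist.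
by apply: functional_extensionality_dep.
Qed.

Lemma lim_map_comp f g s : lim_map (fun x => f (g x)) s = lim_map f (lim_map g s).
Proof.
apply: lim_eq => n; rewrite /=; elim: n (stage s n) => //= n IH z.
have -> : tower_map (fun x => f (g x)) (n := n) =
   fun x => tower_map f (tower_map g x) by apply/funext => x; exact: IH.
exact: map_ext_comp.
Qed.

Lemma lim_map_to f x : lim_map f (to_tower_lim x) = to_tower_lim (f x).
Proof.
apply: lim_eq; elim=> // n IH.
by rewrite -[LHS]/(to_ext (tower_map f (tower_lift n x))) [tower_map _ _]IH.
Qed.

Definition near_id_on (f : X0 -> X0) (A : seq (X0 * rat)) : Prop :=
  forall xd, List.In xd A -> dist_le (f xd.1) xd.1 xd.2.

(** A point of the limit has a finite support in the base; this gives the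
    continuity of the action of [G] on the limit. *)
Lemma small_lim_map (s : tower_lim) e : 0 < e -> exists A : seq (X0 * rat),
  (forall xd, List.In xd A -> 0 < xd.2) /\
  forall f, automorphism f -> near_id_on f A -> dist_le (lim_map f s) s e.
Proof.
move=> e0; case: (s) => s' [N hs].
have [A [pA hA]] : exists A : seq (X0 * rat),
    (forall xd, List.In xd A -> 0 < xd.2) /\
    forall f, automorphism f -> near_id_on f A -> dist_le (tower_map f (s' N)) (s' N) e.
  elim: {hs} N (s' N) e e0 => [|n IH] z e e0.
    exists [:: (z, e)]; split; first by move=> xd [<-|].
    by move=> f _ hf; apply: (hf (z, e)); left.
  have [B [d [d0 hd]]] := small_map_ext z e0.
  have /choice[F hF] : forall y : tower n, exists A : seq (X0 * rat),
      (forall xd, List.In xd A -> 0 < xd.2) /\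
      forall f, automorphism f -> near_id_on f A -> dist_le (tower_map f y) y d.
    by move=> y; exact: IH.
  exists (flatten (map F B)).
  have inF xd : List.In xd (flatten (map F B)) <->
      exists2 y, List.In y B & List.In xd (F y).
    elim: B {hd} => [|b B IHB] /=; first by split=> // -[].
    rewrite List.in_app_iff IHB; split.
      by case=> [h|[y yB h]]; [exists b => //; left|exists y => //; right].
    by case=> y [<-|yB] h; [left|right; exists y].
  split; first by move=> xd /inF[y _]; have [+ _] := hF y; apply.
  move=> f af hf; apply: hd.
    have : automorphism (tower_map f (n := n)) :=
      coherent_map_auto (@tower_map_coherent f) af (leq0n n).
    by case.
  move=> y By; have [_ h] := hF y; apply: h => // xd Ax.
  by apply: hf; apply/inF; exists y.
exists A; split=> // f af hf.
exists N => n Nn.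
have := @coherent_dist (stage (lim_map f (exist _ s' (ex_intro _ N hs)))) s' N n e.
move=> h; apply h => //; last exact: hA.
by move=> m Nm; rewrite /= /stage /= hs.
Qed.
End Limit.

(** * Concentration of measure on Hamming cubes *)

Section Concentration.
Variable K : finType.

Definition cube N := {ffun 'I_N -> K}.

Definition ham N (x y : cube N) : nat := #|[set i | x i != y i]|.

Definition lipschitz N (f : cube N -> rat) : Prop :=
  forall i (x y : cube N), (forall j, j != i -> x j = y j) -> `|f x - f y| <= 1.

Definition cons_cube N (a : K) (x : cube N) : cube N.+1 :=
  [ffun i => if unlift ord0 i is Some j then x j else a].

Lemma sum_cube N (F : cube N.+1 -> rat) :
  \sum_z F z = \sum_a \sum_x F (cons_cube a x).
Proof.
rewrite pair_big /= (reindex (fun p : K * cube N => cons_cube p.1 p.2)) //=.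
exists (fun z : cube N.+1 => (z ord0, [ffun j => z (lift ord0 j)])) => [[a x]|z] _ /=.
  congr (_, _); first by rewrite ffunE unlift_none.
  by apply/ffunP => j; rewrite !ffunE liftK.
by apply/ffunP => i; rewrite ffunE; case: unliftP => [j|] ->; rewrite ?ffunE.
Qed.

(** With the sums replaced by means, the left-hand side is the variance of
    [u], plus that of [v], plus the square of the difference of the means. *)
Lemma sum_sqr_sub (T : finType) (u v : T -> rat) :
  \sum_x \sum_y (u x - v y) ^+ 2 =
  2^-1 * (\sum_x \sum_y (u x - u y) ^+ 2) + 2^-1 * (\sum_x \sum_y (v x - v y) ^+ 2)
  + (\sum_x (u x - v x)) ^+ 2.
Proof.
have E (a b : T -> rat) : \sum_x \sum_y (a x - b y) ^+ 2 =
    #|T|%:R * \sum_x a x ^+ 2 + #|T|%:R * \sum_x b x ^+ 2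
    - 2 * (\sum_x a x) * (\sum_x b x).
  have -> : \sum_x \sum_y (a x - b y) ^+ 2 =
      \sum_x (#|T|%:R * a x ^+ 2 + (\sum_y b y ^+ 2) - 2 * a x * \sum_y b y).
    apply: eq_bigr => x _.
    rewrite (eq_bigr (fun y => a x ^+ 2 + b y ^+ 2 - 2 * a x * b y)); last first.
      by move=> y _; ring.
    by rewrite sumrB big_split /= sumr_const [#|T|%:R * _]mulr_natl -mulr_sumr.
  rewrite sumrB big_split /= -mulr_sumr sumr_const -mulr_suml -mulr_sumr.
  by rewrite [#|T|%:R * (\sum_x b x ^+ 2)]mulr_natl.
by rewrite !E sumrB; field.
Qed.

(** The Efron-Stein inequality, by induction on the number of coordinates:
    fixing one coordinate to be [a] or [b] gives two functions whose means differ
    by at most 1, and [sum_sqr_sub] adds this 1 to the bound. *)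
Lemma lipschitz_variance N (f : cube N -> rat) : lipschitz f ->
  \sum_x \sum_y (f x - f y) ^+ 2 <= N%:R * #|{: cube N}|%:R ^+ 2.
Proof.
elim: N f => [|N IH] f lf.
  rewrite mul0r big1 // => x _; rewrite big1 // => y _.
  suff -> : x = y by rewrite subrr expr0n.
  by apply/ffunP => -[].
set Q := #|{: cube N}|%:R : rat.
have cQ : #|{: cube N.+1}|%:R = #|K|%:R * Q.
  by rewrite /Q !card_ffun !card_ord expnS natrM.
rewrite sum_cube.
under eq_bigr => a _ do under eq_bigr => x _ do rewrite sum_cube.
under eq_bigr => a _ do rewrite exchange_big /=.
have key a b : \sum_x \sum_y (f (cons_cube a x) - f (cons_cube b y)) ^+ 2
    <= N.+1%:R * Q ^+ 2.
  rewrite sum_sqr_sub.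
  have lc c : lipschitz (fun x => f (cons_cube c x)).
    move=> i x y h; apply: (lf (lift ord0 i)) => j ji.
    rewrite !ffunE; case: unliftP => // j' Ej; apply: h.
    by apply: contraNneq ji => <-; rewrite Ej.
  have h1 := IH _ (lc a); have h2 := IH _ (lc b).
  have h3 : (\sum_x (f (cons_cube a x) - f (cons_cube b x))) ^+ 2 <= Q ^+ 2.
    rewrite -real_normK ?num_real // lerXn2r ?nnegrE ?ler0n //.
    apply: le_trans (ler_norm_sum _ _ _) _.
    rewrite /Q -sum1_card natr_sum; apply: ler_sum => x _.
    apply: (lf ord0) => j j0; rewrite !ffunE.
    by case: unliftP j0 => // ->; rewrite eqxx.
  by rewrite -[N.+1%:R]natr1 mulrDl mul1r; rewrite -/Q in h1 h2; lra.
have -> : N.+1%:R * #|{: cube N.+1}|%:R ^+ 2 =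
    \sum_(a : K) \sum_(b : K) (N.+1%:R * Q ^+ 2).
  rewrite !sumr_const -mulrnA -[RHS]mulr_natr natrM cQ.
  rewrite -[#|xpredT|]/#|K|; move: (#|K|%:R : rat) (N.+1%:R : rat) (Q) => k n q.
  by ring.
by apply: ler_sum => a _; apply: ler_sum => b _; exact: key.
Qed.

Lemma ham_triangle N (x y z : cube N) : (ham x z <= ham x y + ham y z)%N.
Proof.
apply: leq_trans (leq_card_setU _ _); apply/subset_leq_card/fintype.subsetP => i.
rewrite !inE; apply: contraNT; rewrite negb_or !negbK => /andP[/eqP -> /eqP ->].
by [].
Qed.

Lemma ham_adj N i (x y : cube N) : (forall j, j != i -> x j = y j) -> (ham x y <= 1)%N.
Proof.
move=> h; rewrite -(cards1 i); apply/subset_leq_card/fintype.subsetP => j.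
by rewrite !inE; apply: contraNT => /h ->.
Qed.

Lemma ham_sym N (x y : cube N) : ham x y = ham y x.
Proof. by apply: eq_card => i; rewrite !inE eq_sym. Qed.

(** For the distance [f] to [A], a 1-Lipschitz function, each pair of a point
    of [A] and a point at distance more than [r] from [A] contributes [r ^ 2] to
    the sum bounded by [lipschitz_variance]. *)
Lemma concentration N r M (A : {set cube N}) :
  (2 * N * M < r ^ 2)%N -> (0 < #|{: cube N}|)%N -> (#|{: cube N}| <= M * #|A|)%N ->
  (#|[set x | [forall a in A, r < ham x a]%N]|.*2 < #|{: cube N}|)%N.
Proof.
move=> NM Q0 dA; set B := [set x | _]; set Q := #|{: cube N}| in Q0 dA *.
have [a0 a0A] : exists a, a \in A.
  apply/set0Pn/eqP => A0; move: dA; rewrite A0 cards0 muln0; lia.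
pose f (x : cube N) : nat := ham x [arg min_(a < a0 in A) ham x a].
have fmin x a : a \in A -> (f x <= ham x a)%N.
  by move=> aA; rewrite /f; case: arg_minnP => // b _; apply.
have fex x : exists2 a, a \in A & f x = ham x a.
  by rewrite /f; case: arg_minnP => // b bA _; exists b.
have fle i (x y : cube N) : (forall j, j != i -> x j = y j) -> (f x <= f y + 1)%N.
  move=> h; have [a aA ->] := fex y; apply: leq_trans (fmin x a aA) _.
  by have := ham_triangle x y a; have := ham_adj h; lia.
have lf : lipschitz (fun x => (f x)%:R).
  move=> i x y h; have h1 := fle _ _ _ h.
  have h2 : (f y <= f x + 1)%N by apply: (fle i) => j /h.
  rewrite ler_norml -(ler_nat rat) in h1 h2 *.
  by move: h1 h2; rewrite -!(ler_nat rat) !natrD; lra.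
have := lipschitz_variance lf; rewrite -/Q => V.
have lower : (#|A| * #|B| * r ^ 2)%:R <=
    \sum_x \sum_y ((f x)%:R - (f y)%:R : rat) ^+ 2.
  apply: (@le_trans _ _ (\sum_x \sum_y
      (if (x \in A) && (y \in B) then r%:R ^+ 2 else 0))).
    rewrite (bigID (mem A)) /= [X in _ + X]big1 ?addr0; last first.
      by move=> x /negbTE xA; apply: big1 => y _; rewrite xA.
    rewrite (eq_bigr (fun=> #|B|%:R * r%:R ^+ 2)); last first.
      by move=> x xA; rewrite xA /= -big_mkcond /= sumr_const mulr_natl.
    by rewrite sumr_const -[X in _ <= X]mulr_natl !natrM expr2 !mulrA.
  apply: ler_sum => x _; apply: ler_sum => y _.
  case: ifP => [/andP[xA yB]|_]; last exact: sqr_ge0.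
  have fx0 : f x = 0%N.
    apply/eqP; rewrite -leqn0; apply: leq_trans (fmin x x xA) _.
    by rewrite leqn0 cards_eq0; apply/eqP/setP => i; rewrite !inE eqxx.
  rewrite fx0 sub0r sqrrN lerXn2r ?nnegrE ?ler0n // ler_nat.
  have [a aA ->] := fex y.
  by move: yB; rewrite inE => /forall_inP/(_ a aA)/ltnW.
have {V lower} : (#|A| * #|B| * r ^ 2 <= N * Q ^ 2)%N.
  by rewrite -(ler_nat rat) (natrM _ N) natrX; exact: le_trans lower V.
rewrite -addnn; move: NM dA Q0; move: #|A| #|B| => a b; clear => NM dA Q0 V.
rewrite ltnNge; apply/negP => Qb.
have h1 : (Q * Q * r ^ 2 <= M * a * (b + b) * r ^ 2)%N.
  by rewrite leq_mul2r leq_mul // orbT.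
have h2 : (M * a * (b + b) * r ^ 2 <= 2 * N * M * Q ^ 2)%N.
  have -> : (M * a * (b + b) * r ^ 2 = 2 * M * (a * b * r ^ 2))%N by ring.
  have -> : (2 * N * M * Q ^ 2 = 2 * M * (N * Q ^ 2))%N by ring.
  by rewrite leq_mul2l V orbT.
have h3 : (2 * N * M * Q ^ 2 < r ^ 2 * Q ^ 2)%N by rewrite ltn_pmul2r // expn_gt0 Q0.
by have := leq_ltn_trans (leq_trans h1 h2) h3; rewrite mulnC mulnn ltnn.
Qed.

End Concentration.

Section Translates.
Variables (K : finGroupType) (M t : nat) (k : 'I_M -> K).

Definition translate_cube N (x : cube K N) (a : K) : cube K N := [ffun i => (x i * a)%g].

Lemma translate_cube_inj N (a : K) : injective (fun x : cube K N => translate_cube x a).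
Proof.
move=> x y /ffunP h; apply/ffunP => i; have := h i.
by rewrite !ffunE => /mulIg.
Qed.

(** Some colour has density at least 1/M, so more than half of the cube is
    within [r] of that colour; a translate of this large part meets it.  The
    radius is a fraction 1/t of the number t * r of coordinates. *)
Lemma near_monochromatic : let r := (2 * t * M).+1 in
  forall chi : cube K (t * r) -> 'I_M, exists s x a b,
    [/\ chi a = s, chi b = s, (ham x a <= r)%N & (ham (translate_cube x (k s)) b <= r)%N].
Proof.
move=> r chi; set Q := #|{: cube K (t * r)}|.
have Q0 : (0 < Q)%N by apply/card_gt0P; exists [ffun=> 1%g].
have [s dA] : exists s, (Q <= M * #|[set x | chi x == s]|)%N.
  apply/existsP; rewrite -[X in is_true X]negbK negb_exists; apply/forallP => h.
  have : (\sum_(s < M) M * #|[set x | chi x == s]| <= \sum_(s < M) Q.-1)%N.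
    by apply: leq_sum => s _; have := h s; rewrite -ltnNge; lia.
  rewrite -big_distrr /= sum_nat_const card_ord.
  have -> : (\sum_(s < M) #|[set x | chi x == s]| = Q)%N.
    rewrite /Q -sum1_card (partition_big chi predT) //=.
    by apply: eq_bigr => s _; rewrite -sum1_card; apply: eq_bigl => x; rewrite inE.
  have M0 : (0 < M)%N by case: (chi [ffun=> 1%g]) => m /=; lia.
  by rewrite leq_pmul2l //; lia.
have rM : (2 * (t * r) * M < r ^ 2)%N by rewrite mulnA mulnAC -mulnn ltn_pmul2r /r //; lia.
have := concentration rM Q0 dA; rewrite -/Q; set B := [set x | _] => cB.
pose B' := [set x | translate_cube x (k s) \in B].
have cB' : (#|B'| <= #|B|)%N.
  rewrite -(card_imset _ (@translate_cube_inj _ (k s))); apply/subset_leq_card/fintype.subsetP => y.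
  by case/imsetP => x; rewrite inE => hx ->.
have [x] : exists x, x \notin B :|: B'.
  apply/existsP; rewrite -[X in is_true X]negbK negb_exists; apply/negP => /forallP h.
  have QB : (Q <= #|B :|: B'|)%N.
    by apply/subset_leq_card/fintype.subsetP => x _; have := h x; rewrite negbK.
  have := leq_trans (leq_trans QB (leq_card_setU B B')) (leq_add (leqnn _) cB').
  by rewrite addnn leqNgt cB.
rewrite !inE negb_or !negb_forall => /andP[/existsP[a] + /existsP[b]].
rewrite !negb_imply !inE -!leqNgt => /andP[/eqP ha ra] /andP[/eqP hb rb].
by exists s, x, a, b.
Qed.

End Translates.

(** * A finite space with many copies of a configuration *)

(** The complements of the domain and of the image have the same size. *)
Lemma perm_extension (T : finType) (D : {set T}) (f : T -> T) :
  {in D &, injective f} -> exists p : {perm T}, forall x, x \in D -> p x = f x.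
Proof.
move=> fI; pose s := enum (~: D); pose s' := enum (~: (f @: D)).
have sz : size s = size s'.
  rewrite -!cardE; have := cardsC (f @: D); rewrite card_in_imset //.
  by rewrite -(cardsC D) => /addnI.
pose h x := if x \in D then f x else nth x s' (index x s).
have hD x : x \notin D -> h x \notin f @: D.
  move=> xD; have xs : x \in s by rewrite mem_enum inE.
  rewrite /h (negbTE xD) -finset.in_setC -mem_enum; apply: mem_nth.
  by rewrite -sz index_mem.
have hI : injective h.
  move=> x y; case xD : (x \in D); case yD : (y \in D).
  - by rewrite /h xD yD; exact: fI.
  - move=> E; have := hD y (negbT yD); rewrite -E /h xD.
    by rewrite imset_f.
  - move=> E; have := hD x (negbT xD); rewrite E /h yD.
    by rewrite imset_f.
  rewrite /h xD yD; have xs : x \in s by rewrite mem_enum inE xD.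
  have ys : y \in s by rewrite mem_enum inE yD.
  have ix : (index x s < size s')%N by rewrite -sz index_mem.
  have iy : (index y s < size s')%N by rewrite -sz index_mem.
  rewrite (set_nth_default x _ iy) => /eqP; rewrite nth_uniq ?enum_uniq // => /eqP.
  by move=> /(congr1 (nth x s)); rewrite !nth_index.
by exists (perm hI) => x xD; rewrite permE /h xD.
Qed.

Section Model.
Variables (G : groupType) (M : nat) (a : 'I_M -> G).

(** The index [None] stands for the identity, so that the configuration
    contains the given points along with their translates. *)
Definition translator (j : option 'I_M) : G := if j is Some s then a s else 1%g.

Fixpoint word_ball n : seq G :=
  if n is n'.+1 then word_ball n' ++ [seq (x * translator j)%g | x <- word_ball n', j <- enum {: option 'I_M}]
    ++ [seq (x * (translator j)^-1)%g | x <- word_ball n', j <- enum {: option 'I_M}]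
  else [:: 1%g].

Lemma ball_le n m : (n <= m)%N -> {subset word_ball n <= word_ball m}.
Proof.
move=> /subnKC <-; elim: (m - n)%N => [|k IH] x xn; first by rewrite addn0.
by rewrite addnS /= mem_cat IH.
Qed.

Lemma ball_mul n x j : x \in word_ball n -> (x * translator j)%g \in word_ball n.+1.
Proof.
move=> xn; rewrite /= !mem_cat; apply/orP; right; apply/orP; left.
by apply/allpairsP; exists (x, j); rewrite mem_enum.
Qed.

Lemma ball_div n x j : x \in word_ball n -> (x * (translator j)^-1)%g \in word_ball n.+1.
Proof.
move=> xn; rewrite /= !mem_cat; apply/orP; right; apply/orP; right.
by apply/allpairsP; exists (x, j); rewrite mem_enum.
Qed.

Variable L : nat.
Definition ball_point := seq_sub (word_ball L).

Lemma ball1 n : 1%g \in word_ball n.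
Proof. by apply: (@ball_le 0) => //; rewrite inE. Qed.

Definition origin : ball_point := SeqSub (ball1 L).

Lemma perm_model_ex j : exists p : {perm ball_point}, forall x : ball_point,
  (ssval x * translator j)%g \in word_ball L -> ssval (p x) = (ssval x * translator j)%g.
Proof.
pose f (x : ball_point) : ball_point := insubd x (ssval x * translator j)%g.
have fE (x : ball_point) : (ssval x * translator j)%g \in word_ball L -> ssval (f x) = (ssval x * translator j)%g.
  by move=> h; rewrite /f -[ssval _]/(val _) insubdK.
pose D := [set x : ball_point | (ssval x * translator j)%g \in word_ball L].
have fI : {in D &, injective f}.
  move=> x y; rewrite !inE => hx hy /(congr1 (@ssval _ _)).
  by rewrite !fE // => /mulIg h; exact: val_inj.
have [p hp] := perm_extension fI.
by exists p => x hx; rewrite hp ?inE // fE.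
Qed.

(** Permutations of a finite ball in which right multiplications are partially
    defined: a short word which is trivial as a permutation fixes the origin,
    hence is trivial in [G]. *)
Definition perm_model j : {perm ball_point} := sval (cid (perm_model_ex j)).

Lemma perm_model_mul n j (x : ball_point) : (n < L)%N -> ssval x \in word_ball n ->
  ssval (perm_model j x) = (ssval x * translator j)%g.
Proof.
move=> nL xn; apply: (svalP (cid (perm_model_ex j))).
exact: ball_le nL _ (ball_mul j xn).
Qed.

Lemma perm_model_div n j (x : ball_point) : (n < L)%N -> ssval x \in word_ball n ->
  ssval ((perm_model j)^-1%g x) = (ssval x * (translator j)^-1)%g.
Proof.
move=> nL xn; have h := ball_le nL (ball_div j xn).
pose y : ball_point := SeqSub h.
have E : perm_model j y = x.
  apply: val_inj; rewrite [LHS](svalP (cid (perm_model_ex j)) y) /= mulgVK //.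
  exact: ssvalP x.
by rewrite -{1}E permK.
Qed.

Lemma perm_model1 : perm_model None = 1%g.
Proof.
apply/permP => x; rewrite perm1; apply: val_inj.
rewrite [LHS](svalP (cid (perm_model_ex None)) x) /= mulg1 //.
exact: ssvalP x.
Qed.

End Model.

Section ModelMetric.
Variables (G : groupType) (X : distSpace) (act : G -> X -> X).
Hypothesis act_iso : forall g, isometry (act g).
Hypothesis actM : forall g h x, act (g * h)%g x = act g (act h x).
Hypothesis act1 : forall x, act 1%g x = x.
Variables (M : nat) (a : 'I_M -> G) (I : finType) (o : I -> X) (t N : nat).

Let L := (2 * t)%N.
Let K : finGroupType := {perm ball_point a L}.
Let k (j : option 'I_M) : K := perm_model a L j.
Let orb (j : option 'I_M) (i : I) : X := act (translator a j) (o i).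

Definition vertex : Type := (cube K N * option 'I_M * I)%type.

(** The copy [x] of the configuration keeps its distances; a jump between two
    copies is cheap when the translates of [x] and [x'] almost agree.  The
    constant part 1/t of its cost bounds the number of jumps. *)
Inductive model_path : vertex -> vertex -> rat -> Prop :=
| model_path_line x j i j' i' c : dist_le (orb j i) (orb j' i') c -> model_path (x, j, i) (x, j', i') c
| model_path_jump x x' j j' i :
    model_path (x, j, i) (x', j', i)
      (t%:R^-1 + (ham (translate_cube x (k j)) (translate_cube x' (k j')))%:R / N%:R)
| model_path_sym z z' c : model_path z z' c -> model_path z' z c
| model_path_trans z z' z'' c e : model_path z z' c -> model_path z' z'' e -> model_path z z'' (c + e)
| model_path_mono z z' c e : c <= e -> model_path z z' c -> model_path z z' e
| model_path_one z z' : model_path z z' 1.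

Lemma model_path_refl z : model_path z z 0.
Proof. by case: z => -[x j] i; apply/model_path_line/dist_refl. Qed.

Lemma model_path_ge0 z z' c : model_path z z' c -> 0 <= c.
Proof.
elim=> {z z' c}.
- by move=> _ j i j' i' c /dist_ge0.
- by move=> x x' j j' i; rewrite addr_ge0 ?invr_ge0 ?divr_ge0 ?ler0n.
- by [].
- by move=> z z' z'' c e _ h1 _ h2; exact: addr_ge0.
- by move=> z z' c e ce _; lra.
- by [].
Qed.

Definition model : distSpace :=
  closure_space (PreDistSpace model_path_refl model_path_sym model_path_trans model_path_mono model_path_ge0 model_path_one).

Lemma model_jump x x' j j' i : @dist_le model (x, j, i) (x', j', i)
  (t%:R^-1 + (ham (translate_cube x (k j)) (translate_cube x' (k j')))%:R / N%:R).
Proof. exact/dist_cl/model_path_jump. Qed.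

Section Shadow.
Variables (x0 : cube K N) (j0 : option 'I_M) (i0 : I).
Hypotheses (t0 : (0 < t)%N) (N0 : (0 < N)%N).

(** A path of cost less than 1 starting at [(x0, j0, i0)] is followed in [X]: [n]
    counts the jumps, [Z] the coordinates of the cube changed so far, and for
    every other coordinate the path spells an element [g] of a small ball which
    is read off from the permutation at that coordinate.  Jumps do not move the
    shadow [act g (orb j i)]. *)
Definition shadow (z : vertex) (c : rat) : Prop :=
  let: (x, j, i) := z in
  1 <= c \/ exists n (Z : {set 'I_N}) e,
    n%:R / t%:R + #|Z|%:R / N%:R + e <= c /\ 0 <= e /\
    forall l, l \notin Z -> exists g, g \in word_ball a (2 * n) /\
      ssval (((x0 l)^-1 * x l)%g (origin a L)) = g /\
      dist_le (orb j0 i0) (act g (orb j i)) e.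

Lemma shadow_mono z c e : c <= e -> shadow z c -> shadow z e.
Proof.
move=> ce; case: z => -[x j] i [c1|[n [Z [d [h1 h2]]]]]; first by left; lra.
by right; exists n, Z, d; split=> //; lra.
Qed.

Lemma shadow_ge0 z c : shadow z c -> 0 <= c.
Proof.
case: z => -[x j] i [c1|[n [Z [d [h1 [d0 _]]]]]]; first by lra.
have h2 : 0 <= n%:R / t%:R :> rat by rewrite divr_ge0 ?ler0n.
have h3 : 0 <= #|Z|%:R / N%:R :> rat by rewrite divr_ge0 ?ler0n.
lra.
Qed.

Lemma shadow_line x j i j' i' c e : dist_le (orb j i) (orb j' i') c ->
  shadow (x, j, i) e -> shadow (x, j', i') (e + c).
Proof.
move=> h; have c0 := dist_ge0 h.
case=> [e1|[n [Z [d [h1 [d0 H]]]]]]; first by left; lra.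
right; exists n, Z, (d + c); split; first lra; split; first exact: addr_ge0.
move=> l /H [g [gn [gE hg]]]; exists g; split=> //; split=> //.
by apply: dist_trans hg _; apply/act_iso.
Qed.

Lemma shadow_jump x x' j j' i e : shadow (x, j, i) e ->
  shadow (x', j', i) (e + (t%:R^-1 + (ham (translate_cube x (k j)) (translate_cube x' (k j')))%:R / N%:R)).
Proof.
set hm := ham _ _.
have tp : 0 < t%:R :> rat by rewrite ltr0n.
have Np : 0 < N%:R :> rat by rewrite ltr0n.
have ti : 0 <= t%:R^-1 :> rat by rewrite invr_ge0 ler0n.
have hi : 0 <= hm%:R / N%:R :> rat by rewrite divr_ge0 ?ler0n.
case=> [e1|[n [Z [d [h1 [d0 H]]]]]]; first by left; lra.
set c := e + _; have [c1|c1] := lerP 1 c; [by left|right].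
pose Z' := Z :|: [set l | translate_cube x (k j) l != translate_cube x' (k j') l].
exists n.+1, Z', d; split; last split => //.
  have hZ : #|Z'|%:R / N%:R <= #|Z|%:R / N%:R + hm%:R / N%:R :> rat.
    by rewrite -mulrDl ler_pM2r ?invr_gt0 // -natrD ler_nat; exact: leq_card_setU.
  by rewrite -natr1 mulrDl mul1r /c; lra.
have nt : (n.+1 < t)%N.
  have h2 : n.+1%:R / t%:R < 1 :> rat.
    have h3 : 0 <= #|Z|%:R / N%:R :> rat by rewrite divr_ge0 ?ler0n.
    by rewrite -natr1 mulrDl mul1r; rewrite /c in c1; lra.
  by move: h2; rewrite ltr_pdivrMr // mul1r ltr_nat.
move=> l; rewrite !inE negb_or negbK => /andP[lZ /eqP].
rewrite !ffunE => El; have [g [gn [gE hg]]] := H l lZ.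
have Ex : (x' l = x l * k j * (k j')^-1)%g by rewrite El mulgK.
exists (g * translator a j * (translator a j')^-1)%g; split.
  by rewrite mulnS; apply/ball_div/ball_mul.
split.
  have y1 : ssval ((((x0 l)^-1 * x l)%g * k j)%g (origin a L)) = (g * translator a j)%g.
    by rewrite permM (@perm_model_mul _ _ _ _ (2 * n)) ?gE //; rewrite /L; lia.
  rewrite Ex !mulgA permM (@perm_model_div _ _ _ _ (2 * n).+1) ?y1 //.
    by rewrite /L; lia.
  exact: ball_mul.
by rewrite /orb -actM mulgVK actM.
Qed.

Lemma shadow_path z z' c : model_path z z' c -> forall e,
  (shadow z e -> shadow z' (e + c)) /\ (shadow z' e -> shadow z (e + c)).
Proof.
elim=> {z z' c}.
- move=> x j i j' i' c h e; split; first exact: shadow_line h.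
  exact: shadow_line (dist_sym h).
- move=> x x' j j' i e; split; first exact: shadow_jump.
  by rewrite ham_sym; exact: shadow_jump.
- by move=> z z' c _ IH e; have [] := IH e.
- move=> z z' z'' c e _ IH1 _ IH2 f; split=> h.
    by rewrite addrA; apply IH2; apply IH1.
  by rewrite (addrC c) addrA; apply IH1; apply IH2.
- move=> z z' c e ce _ IH f; have [h1 h2] := IH f.
  by split=> h; [apply: shadow_mono (h1 h)|apply: shadow_mono (h2 h)]; lra.
- move=> [[x j] i] [[x' j'] i'] e; split=> /shadow_ge0 e0; left; lra.
Qed.

(** When the path is back in the copy [x0], some coordinate is unchanged; there
    the permutation is trivial, so [g] is trivial. *)
Lemma model_line j i c :
  @dist_le model (x0, j0, i0) (x0, j, i) c <-> dist_le (orb j0 i0) (orb j i) c.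
Proof.
split; last by move=> h; apply/dist_cl/model_path_line.
move=> h; apply: dist_closed => e e0.
have start : shadow (x0, j0, i0) 0.
  right; exists 0%N, finset.set0, 0; rewrite finset.cards0 !mul0r !addr0.
  split=> //; split=> // l _; exists 1%g; split; first by rewrite inE.
  split; first by rewrite mulVg perm1.
  by rewrite act1; exact: dist_refl.
have [/(_ start) + _] := shadow_path (h e e0) 0; rewrite add0r.
case; first by move=> h1; exact: dist_mono h1 (dist_one _ _).
move=> [n [Z [d [h1 [d0 H]]]]].
have h2 : 0 <= n%:R / t%:R :> rat by rewrite divr_ge0 ?ler0n.
have h3 : 0 <= #|Z|%:R / N%:R :> rat by rewrite divr_ge0 ?ler0n.
have [c1|c1] := lerP 1 (c + e); first exact: dist_mono c1 (dist_one _ _).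
have Np : 0 < N%:R :> rat by rewrite ltr0n.
have ZN : (#|Z| < N)%N.
  have : #|Z|%:R / N%:R < 1 :> rat by lra.
  by rewrite ltr_pdivrMr // mul1r ltr_nat.
have [l lZ] : exists l, l \notin Z.
  apply/existsP; rewrite -[X in is_true X]negbK negb_exists.
  apply/negP => /forallP hl; move: ZN; rewrite ltnNge -{1}(card_ord N) => /negP; apply.
  by apply/subset_leq_card/fintype.subsetP => l _; have := hl l; rewrite negbK.
have [g [_ [gE hg]]] := H l lZ.
move: gE; rewrite mulVg perm1 /= => gE; rewrite -gE act1 in hg.
by apply: dist_mono hg; lra.
Qed.
End Shadow.
End ModelMetric.

(** * Colourings of a group acting richly by isometries *)

Section Ramsey.
Variables (G : groupType) (X : distSpace) (act : G -> X -> X).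
Hypothesis act_iso : forall g, isometry (act g).
Hypothesis actM : forall g h x, act (g * h)%g x = act g (act h x).
Hypothesis act1 : forall x, act 1%g x = x.
Hypothesis homogeneous : forall p : letter X, valid p -> exists h,
  forall k ab, onth p k = Some ab -> dist_le (act h ab.1) ab.2 0.
Hypothesis universal : forall (E : distSpace) (v : nat -> E), exists c : nat -> X,
  forall n m e, dist_le (c n) (c m) e <-> dist_le (v n) (v m) e.

(** The model space lies in [X] by universality, and by homogeneity each copy
    [x] of the configuration in it is its image under some [h x]; colour the cube
    by the colours of the [h x]. *)
Lemma near_constant_pair M (a : 'I_M -> G) (I : finType) (o : I -> X) (e : rat)
    (chi : G -> 'I_M) : 0 < e -> exists s h h1 h2,
  [/\ chi h1 = s, chi h2 = s, forall i, dist_le (act h (o i)) (act h1 (o i)) e &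
   forall i, dist_le (act (h * a s)%g (o i)) (act h2 (o i)) e].
Proof.
move=> e0; have [i0 _|I0] := pickP I; last first.
  by exists (chi 1%g), 1%g, 1%g, 1%g; split=> // i; have := I0 i.
have [t t0 te] : exists2 t, (0 < t)%N & 3%:R / t%:R <= e.
  have e3 : 0 <= 3%:R / e by rewrite divr_ge0 ?ltW.
  exists (Num.bound (3%:R / e)).+1 => //.
  rewrite ler_pdivrMr ?ltr0n // mulrC -ler_pdivrMr // ltW //.
  by apply: lt_trans (archi_boundP e3) _; rewrite ltr_nat.
pose L := (2 * t)%N; pose K : finGroupType := {perm ball_point a L}.
pose k (j : option 'I_M) : K := perm_model a L j.
have := @near_monochromatic K M t (fun s => k (Some s)).
set r := (2 * t * M).+1; set N := (t * r)%N => /= mono.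
have N0 : (0 < N)%N by rewrite muln_gt0 t0.
pose C := @model G X act M a I o t N.
pose V := (cube K N * option 'I_M * I)%type.
pose z0 : V := ([ffun=> 1%g], None, i0).
have [c hc] := universal (fun n => odflt z0 (unpickle n) : C).
pose p (z : V) : X := c (pickle z).
have pE z z' d : dist_le (p z) (p z') d <-> @dist_le C z z' d.
  by have := hc (pickle z) (pickle z') d; rewrite !pickleK.
have /choice[h hh] : forall x : cube K N, exists h : G, forall j i,
    dist_le (act h (act (translator a j) (o i))) (p (x, j, i)) 0.
  move=> x; pose s := [seq (act (translator a ji.1) (o ji.2), p (x, ji.1, ji.2)) |
    ji <- enum {: option 'I_M * I}].
  have vs : valid s.
    move=> n m ab ab'; rewrite !onth_map.
    case: (onth _ n) => //= -[j i] [<-]; case: (onth _ m) => //= -[j' i'] [<-] d /=.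
    have := pE (x, j, i) (x, j', i') d.
    have := model_line act_iso actM act1 o x j i t0 N0 j' i' d.
    by rewrite -/C; tauto.
  have [g hg] := homogeneous vs; exists g => j i.
  have ji : (j, i) \in enum {: option 'I_M * I} by rewrite mem_enum.
  apply: (hg (index (j, i) (enum {: option 'I_M * I})) (_, _)).
  by rewrite onth_map onthE (nth_map (j, i)) ?index_mem // nth_index.
have hN m : (m <= r)%N -> m%:R / N%:R <= t%:R^-1 :> rat.
  move=> mr; rewrite ler_pdivrMr ?ltr0n // /N natrM mulrA mulVf ?mul1r ?ler_nat //.
  by rewrite pnatr_eq0 -lt0n.
have near (x x' : cube K N) j j' i : (ham (translate_cube x (k j)) (translate_cube x' (k j')) <= r)%N ->
    dist_le (act (h x) (act (translator a j) (o i))) (act (h x') (act (translator a j') (o i))) e.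
  move=> /hN hm; apply: (dist0l (hh x j i)); apply: dist_sym.
  apply: (dist0l (hh x' j' i)); apply: dist_sym; apply/pE.
  apply: dist_mono (@model_jump G X act M a I o t N x x' j j' i).
  by rewrite -/K -/k; move: te hm; set u := t%:R^-1; lra.
have shift1 (x : cube K N) : translate_cube x (k None) = x.
  by apply/ffunP => l; rewrite ffunE /k perm_model1 mulg1.
have [s [x [y [y' [h1 h2 h3 h4]]]]] := mono (fun x => chi (h x)).
exists s, (h x), (h y), (h y'); split=> // i.
  have := @near x y None None i; rewrite !shift1 /= !act1; exact.
have := @near x y' (Some s) None i; rewrite shift1 /= act1 actM; exact.
Qed.

End Ramsey.

Local Open Scope classical_set_scope.
Local Open Scope ring_scope.

(** * The pointwise topology and extreme amenability *)

Record iso_action (G : groupType) := IsoAction {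
  space : distSpace;
  act : G -> space -> space;
  act_iso : forall g, isometry (act g);
  actM : forall g h x, act (g * h)%g x = act g (act h x);
  act1 : forall x, act 1%g x = x }.

(** The group with the topology of pointwise convergence on [space A]. *)
Definition ptw (G : groupType) (A : iso_action G) : Type := G.

Section Pointwise.
Variables (G : groupType) (A : iso_action G).
Let X := space A.
Notation Gt := (ptw A).

HB.instance Definition _ := monoid.Group.copy Gt G.

Definition close_on (F : seq (X * rat)) (g h : G) : Prop :=
  forall xd, List.In xd F -> dist_le (act g xd.1) (act h xd.1) xd.2.

Definition positive_radii (F : seq (X * rat)) : Prop :=
  forall xd, List.In xd F -> 0 < xd.2.

Definition ptw_open : set (set Gt) := [set O | forall g, O g ->
  exists F, positive_radii F /\ forall h, close_on F g h -> O h].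

Lemma ptw_openT : ptw_open setT.
Proof. by move=> g _; exists [::]; split=> // xd []. Qed.

Lemma ptw_openI : setI_closed ptw_open.
Proof.
move=> O O' hO hO' g [/hO [F [pF hF]] /hO' [F' [pF' hF']]].
exists (F ++ F'); split; first by move=> xd /List.in_app_iff[/pF|/pF'].
by move=> h hh; split; [apply: hF|apply: hF'] => xd hxd; apply/hh/List.in_app_iff; [left|right].
Qed.

Lemma ptw_open_bigU (I : Type) (f : I -> set Gt) :
  (forall i, ptw_open (f i)) -> ptw_open (\bigcup_i f i).
Proof.
move=> hf g [i _ /(hf i)[F [pF hF]]]; exists F; split=> // h /hF ?.
by exists i.
Qed.

HB.instance Definition _ := isOpenTopological.Build Gt ptw_openT ptw_openI ptw_open_bigU.

Lemma ptw_nbhsP (g : Gt) (U : set Gt) :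
  nbhs g U <-> exists F, positive_radii F /\ forall h, close_on F g h -> U h.
Proof.
split.
  case=> O [oO Og OU]; have [F [pF hF]] := oO g Og.
  by exists F; split=> // h /hF/OU.
move=> [F [pF hF]].
exists [set k : Gt | exists F', positive_radii F' /\ forall h, close_on F' k h -> U h].
split; last by move=> k [F' [pF' hF']]; apply: hF' => xd hxd; apply: dist_mono (dist_refl _); exact/ltW/pF'.
  move=> k [F' [pF' hF']].
  pose F'' := [seq (xd.1, xd.2 / 2) | xd <- F'].
  have inF'' xd : List.In xd F' -> List.In (xd.1, xd.2 / 2) F''.
    exact: (List.in_map (fun xd => (xd.1, xd.2 / 2))).
  have pF'' : positive_radii F''.
    by move=> xd /List.in_map_iff[yd [<- /pF' yd0]] /=; lra.
  exists F''; split=> // h kh; exists F''; split=> // l hl; apply: hF' => xd hxd.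
  have -> : xd.2 = xd.2 / 2 + xd.2 / 2 by lra.
  exact: dist_trans (kh _ (inF'' _ hxd)) (hl _ (inF'' _ hxd)).
by exists F.
Qed.

Lemma ptw_mulg_continuous : continuous (fun x : Gt * Gt => (x.1 * x.2)%g).
Proof.
move=> [g h] U /= /ptw_nbhsP [F [pF hF]].
pose Fg := [seq (act (h : G) xd.1, xd.2 / 2) | xd <- F].
pose Fh := [seq (xd.1, xd.2 / 2) | xd <- F].
exists ([set g' | close_on Fg g g'], [set h' | close_on Fh h h']) => /=.
  split; apply/ptw_nbhsP.
    by exists Fg; split=> // xd /List.in_map_iff[yd [<- /pF yd0]] /=; lra.
  by exists Fh; split=> // xd /List.in_map_iff[yd [<- /pF yd0]] /=; lra.
move=> [g' h'] /= [gg hh]; apply: hF => xd hxd; rewrite !actM.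
have -> : xd.2 = xd.2 / 2 + xd.2 / 2 by lra.
have := gg _ (List.in_map (fun xd => (act (h : G) xd.1, xd.2 / 2)) _ _ hxd).
have := hh _ (List.in_map (fun xd => (xd.1, xd.2 / 2)) _ _ hxd).
move=> /= h1 h2; apply: dist_trans h2 _; exact/act_iso.
Qed.

Lemma ptw_invg_continuous : continuous (fun x : Gt => (x^-1)%g).
Proof.
move=> g U /= /ptw_nbhsP [F [pF hF]].
pose F' := [seq (act (g^-1 : G)%g xd.1, xd.2) | xd <- F].
apply/ptw_nbhsP; exists F'; split.
  by move=> xd /List.in_map_iff[yd [<- /pF yd0]].
move=> h gh; apply: hF => xd hxd; apply/(act_iso (h : G)).
have := gh _ (List.in_map (fun xd => (act (g^-1 : G)%g xd.1, xd.2)) _ _ hxd).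
by rewrite /= -!actM mulgV (mulgV (h : G)) !act1 actM => /dist_sym.
Qed.

HB.instance Definition _ := isTopologicalGroup.Build Gt ptw_mulg_continuous ptw_invg_continuous.

Lemma ptw_hausdorff :
  (forall g h : G, (forall x : X, dist_le (act g x) (act h x) 0) -> g = h) ->
  hausdorff_space Gt.
Proof.
move=> faithful g h closure_space; apply: faithful => x; apply: dist_closed => e e0.
have e2 : 0 < e / 2 by lra.
have nb (k : Gt) : nbhs k [set l : Gt | dist_le (act (k : G) (x : space A)) (act (l : G) (x : space A)) (e / 2)].
  apply/ptw_nbhsP; exists [:: (x, e / 2)]; split; first by move=> xd [<-|].
  by move=> l /(_ (x, e / 2)); apply; left.
have [k [gk hk]] := closure_space _ _ (nb g) (nb h).
have -> : 0 + e = e / 2 + e / 2 by lra.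
exact: dist_trans gk (dist_sym hk).
Qed.

Hypothesis homogeneous : forall p : letter X, valid p -> exists h : G,
  forall k ab, onth p k = Some ab -> dist_le (act h ab.1) ab.2 0.
Hypothesis universal : forall (E : distSpace) (v : nat -> E), exists c : nat -> X,
  forall n m e, dist_le (c n) (c m) e <-> dist_le (v n) (v m) e.

Lemma positive_lb (F : seq (X * rat)) : positive_radii F ->
  exists2 e, 0 < e & forall xd, List.In xd F -> e <= xd.2.
Proof.
elim: F => [|xd F IH] pF; first by exists 1.
have [yd hyd|e e0 he] := IH; first by apply: pF; right.
exists (Num.min e xd.2); first by rewrite lt_min e0 pF //; left.
move=> yd [<-|/he eyd]; first by rewrite ge_min lexx orbT.
by rewrite ge_min eyd.
Qed.

Lemma In_nth (T : Type) (x : T) s :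
  List.In x s -> exists2 n, (n < size s)%N & nth x s n = x.
Proof.
elim: s => //= y s IH [->|/IH[n ns En]]; first by exists 0%N.
by exists n.+1.
Qed.

(** Besides the cover by the sets [W y], the proof uses smaller open sets [W' y]
    and neighbourhoods of the identity sending [W' y] into [W y]; these absorb
    the error in [near_constant_pair], whose elements are used through their
    inverses. *)
Lemma ptw_extremely_amenable : extremely_amenable Gt.
Proof.
move=> Y al [y0 _] cY hY [al1 alM alc]; apply: contrapT => nofix.
have nf y : exists g : G, al g y <> y.
  by apply: contrapT => h; apply: nofix; exists y => g; apply: contrapT => ?; apply: h; exists g.
have alg (g : Gt) : continuous (al g).
  move=> y U nU; have [[V W] /= [V1 W1] VW] := alc (g, y) U nU.
  by apply: filterS W1 => z Wz; apply: (VW (g, z)); split=> //; exact: nbhs_singleton V1.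
have /choice [D hD] : forall y, exists D : G * seq (X * rat) * set Y * set Y,
    let: (g, F, W', W) := D in
    [/\ positive_radii F, open W', W' y,
      forall v z, close_on F 1%g v -> W' z -> W (al v z) &
      forall z, W z -> ~ W (al g z)].
  move=> y; have [g gy] := nf y.
  have [[P Q] /= [Py Qgy] [oP oQ /eqP PQ]] : exists2 AB, (y \in AB.1 /\ al g y \in AB.2) &
      [/\ open AB.1, open AB.2 & AB.1 `&` AB.2 == set0].
    by move: hY; rewrite open_hausdorff; apply; apply/eqP => /esym.
  rewrite !inE in Py Qgy.
  pose W := P `&` al g @^-1` Q.
  have nW : nbhs y W.
    apply: filterI; first exact: open_nbhs_nbhs.
    by apply: alg; exact: open_nbhs_nbhs.
  have : nbhs (al 1%g y) W by rewrite al1.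
  move=> nW1'; have [[V W1] /= [/ptw_nbhsP[F [pF hF]] nW1] VW] := alc (1%g, y) W nW1'.
  exists (g, F, interior W1, W); split=> //.
  - exact: open_interior.
  - by move=> v z hv Wz; apply: (VW (v, z)); split; [exact: hF|exact: interior_subset].
  move=> z [_ Qz] [Pgz _].
  by suff : set0 (al g z) by []; rewrite -PQ.
pose gy y := (D y).1.1.1; pose Fy y := (D y).1.1.2.
pose W' y := (D y).1.2; pose W y := (D y).2.
have hpF y : positive_radii (Fy y) by move: (hD y); rewrite /Fy; case: (D y) => [[[? ?] ?] ?] [].
have hoW y : open (W' y) by move: (hD y); rewrite /W'; case: (D y) => [[[? ?] ?] ?] [].
have hW'y y : W' y y by move: (hD y); rewrite /W'; case: (D y) => [[[? ?] ?] ?] [].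
have hVW y v z : close_on (Fy y) 1%g v -> W' y z -> W y (al v z).
  by move: (hD y); rewrite /W' /W /Fy; case: (D y) => [[[? ?] ?] ?] [_ _ _ + _]; apply.
have hgW y z : W y z -> ~ W y (al (gy y) z).
  by move: (hD y); rewrite /gy /W; case: (D y) => [[[? ?] ?] ?] [_ _ _ _ +]; apply.
have [S _ hS] : finite_subset_cover setT W' [set: Y].
  pose Yp : ptopologicalType := HB.pack (Topological.sort Y) (isPointed.Build _ y0).
  have : @compact Yp setT by exact: cY.
  rewrite compact_cover; apply; first by move=> i _; exact: hoW.
  by move=> y _; exists y.
pose s : seq Y := finmap.enum_fset S; pose M := size s.
pose pt (i : 'I_M) : Y := nth y0 s i.
have /choice [chi hchi] : forall h : G, exists i : 'I_M, W' (pt i) (al (h^-1)%g y0).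
  move=> h; have [y yS hy] := hS (al (h^-1)%g y0) I.
  have ys : (index y s < M)%N by rewrite index_mem.
  by exists (Ordinal ys); rewrite /pt /= nth_index.
pose F := flatten [seq Fy (pt i) | i <- enum 'I_M].
have inF i xd : List.In xd (Fy (pt i)) -> List.In xd F.
  move=> h; rewrite /F; have : i \in enum 'I_M by rewrite mem_enum.
  elim: (enum _) => //= j r IH; rewrite inE List.in_app_iff => /orP[/eqP <-|/IH ?]; first by left.
  by right.
have pF : positive_radii F.
  rewrite /F; elim: (enum _) => //= j r IH xd /List.in_app_iff[|/IH //].
  exact: hpF.
have [e e0 he] := positive_lb pF.
have [i [h [h1 [h2 [c1 c2 d1 d2]]]]] := near_constant_pair (@act_iso _ A) (@actM _ A)
  (@act1 _ A) homogeneous universal (fun i => (gy (pt i))^-1%g)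
  (fun j : 'I_(size F) => (tnth (in_tuple F) j).1) chi e0.
have inFo xd : List.In xd F -> exists j : 'I_(size F), tnth (in_tuple F) j = xd.
  by move=> hx; have [n nF En] := In_nth hx; exists (Ordinal nF); rewrite (tnth_nth xd).
have key (k k' : G) : (forall j : 'I_(size F),
      dist_le (act k (tnth (in_tuple F) j).1) (act k' (tnth (in_tuple F) j).1) e) ->
    chi k' = i -> W (pt i) (al (k^-1)%g y0).
  move=> kk ck'; have -> : (k^-1 = (k^-1 * k') * k'^-1)%g by rewrite mulgK.
  rewrite alM; apply: hVW; last by rewrite -ck'.
  move=> xd hxd; rewrite act1 actM; apply/(act_iso (k : G)); rewrite -!actM mulgV mul1g.
  have hF := inF i _ hxd; have [j Ej] := inFo _ hF.
  by have := kk j; rewrite Ej; apply: dist_mono; exact: he.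
have w1 := key _ _ d1 c1.
have := key _ _ d2 c2; rewrite invMg invgK alM.
exact: hgW.
Qed.

End Pointwise.

(** * Neighbourhoods of the identity *)

Section TopGroupFacts.
Variable G : topologicalGroupType.

Lemma nbhs_mul (g h : G) (U : set G) : nbhs (g * h)%g U -> exists V W,
  [/\ nbhs g V, nbhs h W & forall x y, V x -> W y -> U (x * y)%g].
Proof.
move=> nU; have [[V W] /= [nV nW] VW] := @mulg_continuous G (g, h) U nU.
by exists V, W; split=> // x y Vx Wy; exact: (VW (x, y)).
Qed.

Lemma nbhs_inv (g : G) (U : set G) : nbhs (g^-1)%g U -> nbhs g [set x | U (x^-1)%g].
Proof. by move=> nU; exact: (@invg_continuous G g U nU). Qed.

Lemma nbhs_mull (g h : G) (U : set G) : nbhs (g * h)%g U -> nbhs h [set x | U (g * x)%g].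
Proof.
move=> /nbhs_mul[V [W [nV nW VW]]]; apply: filterS nW => x Wx; apply: VW => //.
exact: nbhs_singleton.
Qed.

Lemma nbhs_mulr (g h : G) (U : set G) : nbhs (g * h)%g U -> nbhs g [set x | U (x * h)%g].
Proof.
move=> /nbhs_mul[V [W [nV nW VW]]]; apply: filterS nV => x Vx; apply: VW => //.
exact: nbhs_singleton.
Qed.

Lemma nbhs_cube_root (U : set G) : nbhs (1%g : G) U -> exists V : set G,
  [/\ nbhs (1%g : G) V, forall x, V x -> V (x^-1)%g &
    forall x y z, V x -> V y -> V z -> U (x * y * z)%g].
Proof.
move=> nU.
have root W : nbhs (1%g : G) W -> exists2 V, nbhs (1%g : G) V &
    forall x y, V x -> V y -> W (x * y)%g.
  move=> nW; have : nbhs (1 * 1 : G)%g W by rewrite mulg1.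
  move=> /nbhs_mul[V [V' [nV nV' VW]]]; exists (V `&` V'); first exact: filterI.
  by move=> x y [Vx _] [_ Vy]; exact: VW.
have [W nW hW] := root U nU; have [V nV hV] := root W nW.
have nV' : nbhs (1%g : G) [set x | V (x^-1)%g] by apply: nbhs_inv; rewrite invg1.
exists (V `&` [set x | V (x^-1)%g]); split.
- exact: filterI.
- by move=> x [Vx Vx'] /=; split; rewrite /= ?invgK.
- move=> x y z [Vx _] [Vy _] [Vz _]; apply: hW; first exact: hV.
  rewrite -[z]mulg1; apply: hV => //; exact: nbhs_singleton nV.
Qed.

(** The sequences of neighbourhoods that define the chain distances of
    Birkhoff and Kakutani. *)
Record nbsys := Nbsys {
  nb :> nat -> set G;
  nb_nbhs : forall n, nbhs (1%g : G) (nb n);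
  nb_inv : forall n x, nb n x -> nb n (x^-1)%g;
  nb_mul : forall n x y z, nb n.+1 x -> nb n.+1 y -> nb n.+1 z -> nb n (x * y * z)%g }.

Lemma nbsys_ex (U : set G) : nbhs (1%g : G) U -> exists V : nbsys, V 0%N `<=` U.
Proof.
move=> nU.
pose T := {V : set G | nbhs (1%g : G) V /\ forall x, V x -> V (x^-1)%g}.
have /choice[next hnext] : forall V : T, exists W : T, forall x y z,
    sval W x -> sval W y -> sval W z -> sval V (x * y * z)%g.
  move=> [V [nV sV]]; have [W [nW sW WV]] := nbhs_cube_root nV.
  by exists (exist _ W (conj nW sW)).
have [V0 [nV0 sV0 V0U]] := nbhs_cube_root nU.
pose V n : T := iter n next (exist _ V0 (conj nV0 sV0)).
have hV n x y z : sval (V n.+1) x -> sval (V n.+1) y -> sval (V n.+1) z ->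
    sval (V n) (x * y * z)%g by exact: hnext.
exists (@Nbsys (fun n => sval (V n)) (fun n => (svalP (V n)).1)
  (fun n => (svalP (V n)).2) hV).
move=> x /= V0x; rewrite -[x]mulg1 -[x]mulg1.
by apply: V0U => //; exact: nbhs_singleton.
Qed.

Section Walk.
Variable V : nbsys.
(** A walk multiplies by elements of the neighbourhoods; a step in [V n] costs
    2 ^ -n. *)
Definition walk := seq (nat * G).
Implicit Types s : walk.
Definition weight s : rat := \sum_(nv <- s) 2^-1 ^+ nv.1.
Definition endpoint s : G := foldr (fun nv g => nv.2 * g)%g 1%g s.
Definition admissible s : Prop := forall nv, List.In nv s -> V nv.1 nv.2.

Lemma weight_cat s s' : weight (s ++ s') = weight s + weight s'.
Proof. exact: big_cat. Qed.
Lemma weight_cons nv s : weight (nv :: s) = 2^-1 ^+ nv.1 + weight s.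
Proof. exact: big_cons. Qed.
Lemma weight_ge0 s : 0 <= weight s.
Proof. by apply: sumr_ge0 => nv _; rewrite exprn_ge0. Qed.
Lemma endpoint_cat s s' : endpoint (s ++ s') = (endpoint s * endpoint s')%g.
Proof. by elim: s => [|nv s IH] /=; rewrite ?mul1g // IH mulgA. Qed.

Lemma weight_split s (h : rat) : s <> [::] -> 0 <= h <= weight s ->
  exists s1 nv s2, [/\ s = s1 ++ nv :: s2, weight s1 <= h & weight s2 <= weight s - h].
Proof.
elim: s h => // nv s IH h _ /andP[h0 hs]; have [hx|hx] := lerP h (2^-1 ^+ nv.1).
  exists [::], nv, s; split=> //; first by rewrite /weight big_nil.
  by rewrite weight_cons; lra.
rewrite weight_cons in hs.
have sn : s <> [::] by move=> s0; move: hs; rewrite s0 /weight big_nil; lra.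
have [|s1 [nv' [s2 [E h1 h2]]]] := IH (h - 2^-1 ^+ nv.1) sn; first by apply/andP; split; lra.
by exists (nv :: s1), nv', s2; split; rewrite ?E ?weight_cons //; rewrite -?E; lra.
Qed.

Lemma nb1 n : V n 1%g. Proof. exact: nbhs_singleton (nb_nbhs V n). Qed.

Lemma nb_le n m : (n <= m)%N -> V m `<=` V n.
Proof.
move=> /subnKC <-; elim: (m - n)%N => [|k IH]; first by rewrite addn0.
rewrite addnS => x h; apply: IH; rewrite -[x]mulg1 -[x]mulg1.
by apply: nb_mul => //; exact: nb1.
Qed.

Lemma half_expS n : 2^-1 ^+ n.+1 = 2^-1 ^+ n / 2 :> rat.
Proof. by rewrite exprS mulrC. Qed.

(** Birkhoff and Kakutani: split the walk at its half-weight into two walks of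
    half the weight and one step in between, which all end in [V n.+1]. *)
Lemma endpoint_nb s n : admissible s -> weight s < 2^-1 ^+ n -> V n (endpoint s).
Proof.
move: {2}(size s) (leqnn (size s)) => k.
elim: k s n => [|k IH] s n sk adm ws.
  by move: sk; rewrite leqn0 size_eq0 => /eqP ->; exact: nb1.
have [->|/eqP s0] := eqVneq s [::]; first exact: nb1.
have w0 := weight_ge0 s.
have [|s1 [nv [s2 [E h1 h2]]]] := @weight_split s (weight s / 2) s0.
  by apply/andP; split; lra.
have szs : (size s1 + size s2 <= k)%N.
  by move: sk; rewrite E size_cat /= addnS.
have adm1 : admissible s1 by move=> x hx; apply: adm; rewrite E List.in_app_iff; left.
have adm2 : admissible s2 by move=> x hx; apply: adm; rewrite E List.in_app_iff; right; right.
have admx : V nv.1 nv.2 by apply: adm; rewrite E List.in_app_iff; right; left.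
have wx : 2^-1 ^+ nv.1 < 2^-1 ^+ n :> rat.
  have := weight_ge0 s1; have := weight_ge0 s2.
  by move: ws; rewrite E weight_cat weight_cons; lra.
have nx : (n < nv.1)%N.
  rewrite ltnNge; apply/negP => le; move: wx; rewrite ltNge => /negP; apply.
  by apply: ler_wiXn2l => //; lra.
rewrite E endpoint_cat /= mulgA; apply: nb_mul.
- apply: IH => //; first exact: leq_trans (leq_addr _ _) szs.
  by rewrite half_expS; lra.
- exact: nb_le nx _ admx.
- apply: IH => //; first exact: leq_trans (leq_addl _ _) szs.
  by rewrite half_expS; lra.
Qed.

Definition walk_dist (x y : G) (c : rat) : Prop :=
  exists s, [/\ admissible s, y = (x * endpoint s)%g & weight s <= c].

Lemma walk_refl x : walk_dist x x 0.
Proof. by exists [::]; split=> //; rewrite ?mulg1 // /weight big_nil. Qed.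

Lemma walk_trans x y z c e : walk_dist x y c -> walk_dist y z e -> walk_dist x z (c + e).
Proof.
move=> [s [hs -> ws]] [s' [hs' -> ws']]; exists (s ++ s'); split.
- by move=> nv /List.in_app_iff[/hs|/hs'].
- by rewrite endpoint_cat mulgA.
- by rewrite weight_cat lerD.
Qed.

Lemma walk_sym x y c : walk_dist x y c -> walk_dist y x c.
Proof.
move=> [s [hs Ey ws]]; exists (rev [seq (nv.1, nv.2^-1)%g | nv <- s]); split.
- elim: s hs {Ey ws} => //= nv s IH hs xd; rewrite rev_cons -cats1.
  move=> /List.in_app_iff[h|/= [<-|//]].
    by apply: IH h => yd hyd; apply: hs; right.
  by apply: nb_inv; apply: (hs nv); left.
- rewrite Ey -mulgA; suff -> : (endpoint s * endpoint (rev [seq (nv.1, nv.2^-1) | nv <- s]) = 1)%g.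
    by rewrite mulg1.
  elim: s {hs Ey ws} => [|nv s IH] /=; first by rewrite mulg1.
  by rewrite rev_cons -cats1 endpoint_cat /= mulg1 mulgA -(mulgA nv.2) IH mulg1 mulgV.
- apply: le_trans ws; rewrite /weight -[X in _ <= X](big_map (fun nv => nv.1) xpredT (fun n => 2^-1 ^+ n)).
  rewrite -(big_map (fun nv => nv.1) xpredT (fun n => 2^-1 ^+ n)).
  rewrite map_rev -map_comp le_eqVlt; apply/orP; left; apply/eqP.
  by apply: perm_big; rewrite perm_rev.
Qed.

Lemma walk_ge0 x y c : walk_dist x y c -> 0 <= c.
Proof. by move=> [s [_ _]]; apply: le_trans; exact: weight_ge0. Qed.

Lemma walk_step x n v : V n v -> walk_dist x (x * v)%g (2^-1 ^+ n).
Proof.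
move=> Vv; exists [:: (n, v)]; split; first by move=> nv [<-|].
  by rewrite /= mulg1.
by rewrite weight_cons /weight big_nil addr0.
Qed.

Lemma walk_mull g x y c : walk_dist (g * x)%g (g * y)%g c <-> walk_dist x y c.
Proof.
split=> -[s [hs Es ws]]; exists s; split=> //.
  by move: Es; rewrite -mulgA => /mulgI.
by rewrite Es mulgA.
Qed.

End Walk.
End TopGroupFacts.

(** * The base space *)

Section Pullback.
Variables (T : Type) (X : distSpace) (f : T -> X).
Definition pull_dist (x y : T) c := dist_le (f x) (f y) c.
Definition pull_pre : preDistSpace :=
  @PreDistSpace T pull_dist (fun x => dist_refl (f x)) (fun x y c => @dist_sym X (f x) (f y) c)
    (fun x y z c e => @dist_trans X (f x) (f y) (f z) c e)
    (fun x y c e => @dist_mono X (f x) (f y) c e)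
    (fun x y c => @dist_ge0 X (f x) (f y) c) (fun x y => dist_one (f x) (f y)).
Lemma pull_closed (x y : pull_pre) c :
  (forall e, 0 < e -> pre_dist x y (c + e)) -> pre_dist x y c.
Proof. exact: dist_closed. Qed.
Definition pullback : distSpace := DistSpace pull_closed.
End Pullback.

(** The distances on [nat] are listed separately from [distSpace] so that all of
    them fit into one distance space. *)
Record natDist := NatDist {
  nat_dist :> nat -> nat -> rat -> Prop;
  nat_dist_refl : forall n, nat_dist n n 0;
  nat_dist_sym : forall n m c, nat_dist n m c -> nat_dist m n c;
  nat_dist_trans : forall n m k c e, nat_dist n m c -> nat_dist m k e -> nat_dist n k (c + e);
  nat_dist_mono : forall n m c e, c <= e -> nat_dist n m c -> nat_dist n m e;
  nat_dist_ge0 : forall n m c, nat_dist n m c -> 0 <= c;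
  nat_dist_one : forall n m, nat_dist n m 1 }.

Section Base.
Variable G : topologicalGroupType.

(** The disjoint union of copies of [G], for the chain distances, and of
    copies of [nat], for all distances; [G] acts on the former by left
    translations and fixes the latter. *)
Definition base_car : Type := ((nbsys G * G) + (natDist * nat))%type.

Definition base_rel (x y : base_car) (c : rat) : Prop :=
  match x, y with
  | inl (V, g), inl (W, h) => V = W /\ walk_dist V g h c
  | inr (D, n), inr (E, m) => D = E /\ nat_dist D n m c
  | _, _ => False
  end.

Definition base_dist (x y : base_car) (c : rat) : Prop := 1 <= c \/ base_rel x y c.

Lemma walk_mono (V : nbsys G) g h c e : c <= e -> walk_dist V g h c -> walk_dist V g h e.
Proof. by move=> ce [s [hs E ws]]; exists s; split=> //; exact: le_trans ce. Qed.

Lemma base_refl x : base_dist x x 0.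
Proof.
right; case: x => [[V g]|[D n]] /=; split=> //; first exact: walk_refl.
exact: nat_dist_refl.
Qed.
Lemma base_sym x y c : base_dist x y c -> base_dist y x c.
Proof.
case=> [c1|h]; [by left|right].
case: x y h => [[V g]|[D n]] [[W h]|[E m]] //= [-> H]; split=> //; first exact: walk_sym.
exact: nat_dist_sym.
Qed.
Lemma base_ge0 x y c : base_dist x y c -> 0 <= c.
Proof.
case=> [c1|]; first exact: le_trans c1.
by case: x y => [[V g]|[D n]] [[W h]|[E m]] //= [_]; [exact: walk_ge0|exact: nat_dist_ge0].
Qed.
Lemma base_trans x y z c e : base_dist x y c -> base_dist y z e -> base_dist x z (c + e).
Proof.
move=> h k; have c0 := base_ge0 h; have e0 := base_ge0 k.
case: h => [c1|h]; first by left; lra.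
case: k => [e1|k]; [by left; lra|right].
case: x y z h k => [[V g]|[D n]] [[W h]|[E m]] [[U k]|[F l]] //= [E1 H] [E2 K]; split; try congruence; subst.
  exact: walk_trans H K.
exact: nat_dist_trans H K.
Qed.
Lemma base_mono x y c e : c <= e -> base_dist x y c -> base_dist x y e.
Proof.
move=> ce [c1|h]; first by left; lra.
right; case: x y h => [[V g]|[D n]] [[W h]|[E m]] //= [-> H]; split=> //.
  exact: walk_mono H.
exact: nat_dist_mono H.
Qed.
Lemma base_one x y : base_dist x y 1. Proof. by left. Qed.

Definition base_space : distSpace :=
  closure_space (PreDistSpace base_refl base_sym base_trans base_mono base_ge0 base_one).

Definition base_act (g : G) (x : base_space) : base_space :=
  match x with inl (V, h) => inl (V, g * h)%g | inr z => inr z end.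

Lemma base_act_mul g h x : base_act (g * h)%g x = base_act g (base_act h x).
Proof. by case: x => [[V k]|z] //=; rewrite mulgA. Qed.

Lemma base_act_one x : base_act 1%g x = x.
Proof. by case: x => [[V k]|z] //=; rewrite mul1g. Qed.

Lemma base_act_auto g : automorphism (base_act g).
Proof.
split; last first.
  move=> y; exists (base_act g^-1%g y).
  by rewrite -base_act_mul mulgV base_act_one; exact: dist_refl.
move=> x y c.
suff H e : base_dist (base_act g x) (base_act g y) e <-> base_dist x y e.
  by split=> h e e0; apply/H; exact: h.
rewrite /base_dist; case: x y => [[V h]|[D n]] [[W k]|[E m]] //=.
by have := walk_mull V g h k e; intuition.
Qed.

Lemma base_act_continuous (x : base_space) (e : rat) : 0 < e ->
  nbhs (1%g : G) [set g | dist_le (base_act g x) x e].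
Proof.
move=> e0; case: x => [[V h]|z]; last by apply: filterS filterT => g _; exact: (dist_mono (ltW e0) (dist_refl _)).
have [n ne] : exists n, 2^-1 ^+ n <= e.
  exists (Num.bound e^-1); rewrite exprVn -[e in _ <= e]invrK lef_pV2 ?posrE ?exprn_gt0 ?invr_gt0 //.
  apply/ltW/(lt_le_trans (archi_boundP _)); first by rewrite invr_ge0 ltW.
  by rewrite -natrX ler_nat ltnW // ltn_expl.
have : nbhs (1%g : G) [set g | V n (h^-1 * g * h)%g].
  apply: (@nbhs_mull _ h^-1%g 1%g [set g | V n (g * h)%g]); rewrite mulg1.
  by apply: nbhs_mulr; rewrite mulVg; exact: nb_nbhs.
apply: filterS => g Vg; apply: (dist_mono ne); apply: dist_sym; apply: dist_cl; right; split=> //.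
have -> : (g * h = h * (h^-1 * g * h))%g by rewrite !mulgA mulgV mul1g.
exact: walk_step.
Qed.

(** The copies of [G] see every neighbourhood of the identity: this makes the
    action a topological embedding. *)
Lemma base_act_near (V : nbsys G) (g : G) :
  @dist_le base_space (inl (V, 1%g)) (base_act g (inl (V, 1%g))) 2^-1 -> V 0%N g.
Proof.
move=> h; have e4 : 0 < 4%:R^-1 :> rat by [].
have [|[_ [s [hs Es ws]]]] := h _ e4; first by lra.
rewrite mulg1 mul1g in Es; rewrite Es.
by apply: endpoint_nb => //; rewrite expr0; lra.
Qed.

Lemma base_universal (E : distSpace) (v : nat -> E) : exists c : nat -> base_space,
  forall n m e, dist_le (c n) (c m) e <-> dist_le (v n) (v m) e.
Proof.
pose D := @NatDist (fun n m => dist_le (v n) (v m)) (fun n => dist_refl (v n))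
  (fun n m c => @dist_sym E (v n) (v m) c) (fun n m k c e => @dist_trans E (v n) (v m) (v k) c e)
  (fun n m c e => @dist_mono E (v n) (v m) c e) (fun n m c => @dist_ge0 E (v n) (v m) c)
  (fun n m => dist_one (v n) (v m)).
exists (fun n => inr (D, n)) => n m e; split.
  move=> h; apply: dist_closed => d d0; case: (h d d0) => [d1|[_]] //.
  exact: dist_mono d1 (dist_one _ _).
by move=> h; apply: dist_cl; right.
Qed.

End Base.

(** * The separated quotient and its isometry group *)

Section Separation.
Variable L : distSpace.

Lemma rep_ex : exists r : L -> L,
  (forall x, dist_le (r x) x 0) /\ forall x y, dist_le x y 0 -> r x = r y.
Proof.
have ex (x : L) : exists y, dist_le y x 0 by exists x; exact: dist_refl.
exists (fun x => sval (cid (ex x))); split=> [x|x y xy]; first exact: svalP (cid (ex x)).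
move: (ex x) (ex y).
have -> : (fun z => dist_le z x 0) = (fun z => dist_le z y 0).
  apply/funext => z; apply/propext; exact: dist0_eq (dist_refl z) xy.
by move=> h k; rewrite (Prop_irrelevance h k).
Qed.

Definition canon_rep : L -> L := sval (cid rep_ex).
Lemma rep_dist x : dist_le (canon_rep x) x 0. Proof. exact: (svalP (cid rep_ex)).1. Qed.
Lemma rep_eq x y : dist_le x y 0 -> canon_rep x = canon_rep y. Proof. exact: (svalP (cid rep_ex)).2. Qed.

(** The quotient by the relation of being at distance 0, realised by one
    representative in each class. *)
Definition sep_car : Type := {x : L | canon_rep x = x}.
Definition sep : distSpace := pullback (fun x : sep_car => sval x).

Lemma rep_rep x : canon_rep (canon_rep x) = canon_rep x. Proof. exact/rep_eq/rep_dist. Qed.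
Definition to_sep (x : L) : sep := exist _ (canon_rep x) (rep_rep x).

Lemma to_sep_dist x y c : dist_le (to_sep x) (to_sep y) c <-> dist_le x y c.
Proof. exact: (dist0_eq c (rep_dist x) (rep_dist y)). Qed.

Lemma sep_eq (x y : sep) : dist_le x y 0 -> x = y.
Proof.
case: x y => x hx [y hy] h; apply: eq_exist.
by rewrite -hx -hy; exact: rep_eq.
Qed.

Lemma to_sepK (x : sep) : to_sep (sval x) = x.
Proof. by apply: sep_eq; exact: rep_dist. Qed.
End Separation.

Section IsometryGroup.
Variable L : distSpace.
Let Q := sep L.

Definition isom_group : Type := {f : Q -> Q | isometry f /\ forall y, exists x, f x = y}.

Lemma isom_group_eq (f g : isom_group) : (forall x, sval f x = sval g x) -> f = g.
Proof. by case: f g => f hf [g hg] /= h; apply/eq_exist/funext. Qed.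

Lemma isom_group_one_proof : isometry (@id Q) /\ forall y : Q, exists x, id x = y.
Proof. by split=> // y; exists y. Qed.
Definition isom_group_one : isom_group := exist _ _ isom_group_one_proof.

Lemma isom_group_mul_proof (f g : isom_group) : isometry (fun x => sval f (sval g x)) /\
  forall y, exists x, sval f (sval g x) = y.
Proof.
case: f g => f [isof sf] [g [isog sg]] /=; split.
  by move=> x y c; have := isof (g x) (g y) c; have := isog x y c; tauto.
by move=> y; have [z <-] := sf y; have [x <-] := sg z; exists x.
Qed.
Definition isom_group_mul (f g : isom_group) : isom_group := exist _ _ (isom_group_mul_proof f g).

Lemma isom_group_inv_ex (f : isom_group) : exists g : isom_group,
  (forall x, sval f (sval g x) = x) /\ (forall x, sval g (sval f x) = x).
Proof.
case: f => f [isof sf]; have /choice[g hg] := sf.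
have gf x : g (f x) = x.
  by apply: sep_eq; apply/isof; rewrite hg; exact: dist_refl.
have isog : isometry g.
  by move=> x y c; have := isof (g x) (g y) c; rewrite !hg; tauto.
by exists (exist _ g (conj isog (fun y => ex_intro _ (f y) (gf y)))).
Qed.
Definition isom_group_inv (f : isom_group) : isom_group := sval (cid (isom_group_inv_ex f)).

HB.instance Definition _ := gen_eqMixin isom_group.
HB.instance Definition _ := gen_choiceMixin isom_group.

Lemma isom_group_mulA : associative isom_group_mul. Proof. by move=> f g h; exact: isom_group_eq. Qed.
Lemma isom_group_mul1 : left_id isom_group_one isom_group_mul. Proof. by move=> f; exact: isom_group_eq. Qed.
Lemma isom_group_mulr1 : right_id isom_group_one isom_group_mul. Proof. by move=> f; exact: isom_group_eq. Qed.
Lemma isom_group_mulV : left_inverse isom_group_one isom_group_inv isom_group_mul.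
Proof. by move=> f; apply: isom_group_eq => x /=; exact: (svalP (cid (isom_group_inv_ex f))).2. Qed.
Lemma isom_group_mulrV : right_inverse isom_group_one isom_group_inv isom_group_mul.
Proof. by move=> f; apply: isom_group_eq => x /=; exact: (svalP (cid (isom_group_inv_ex f))).1. Qed.

HB.instance Definition _ := isGroup.Build isom_group isom_group_mulA isom_group_mul1 isom_group_mulr1 isom_group_mulV isom_group_mulrV.

Definition isom_group_act : iso_action isom_group :=
  @IsoAction isom_group Q (fun f => sval f) (fun f => (svalP f).1) (fun f g x => erefl) (fun x => erefl).

Lemma isom_group_of_auto_proof (f : L -> L) : automorphism f ->
  isometry (fun x : Q => to_sep (f (sval x))) /\
  forall y : Q, exists x : Q, to_sep (f (sval x)) = y.
Proof.
move=> [isof sf]; split.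
  move=> x y c; have := isof (sval x) (sval y) c.
  have := to_sep_dist (f (sval x)) (f (sval y)) c.
  by rewrite -/Q; have E : dist_le x y c <-> dist_le (sval x) (sval y) c by []; tauto.
move=> y; have [x hx] := sf (sval y); exists (to_sep x).
apply: sep_eq; rewrite -[y]to_sepK; apply/to_sep_dist.
apply: dist0r hx _; apply/isof; exact: rep_dist.
Qed.
Definition isom_group_of_auto f (af : automorphism f) : isom_group := exist _ _ (isom_group_of_auto_proof af).

End IsometryGroup.

(** * The embedding *)

Section Embedding.
Variables (G H : topologicalGroupType) (f : G -> H).
Hypothesis fM : {morph f : x y / (x * y)%g}.

Lemma morph_inv x : f (x^-1)%g = ((f x)^-1)%g.
Proof.
have f1 : f 1%g = 1%g by apply: (@mulgI _ (f 1%g)); rewrite -fM !mulg1.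
by apply: (@mulgI _ (f x)); rewrite -fM !mulgV.
Qed.

Lemma morph_continuous : (forall U : set H, nbhs (1%g : H) U -> nbhs (1%g : G) (f @^-1` U)) ->
  continuous f.
Proof.
move=> f1 g U nU.
have : nbhs (1%g : H) [set k | U (f g * k)%g] by apply: nbhs_mull; rewrite mulg1.
move=> /f1 n1; have : nbhs (g^-1 * g)%g (f @^-1` [set k | U (f g * k)%g]) by rewrite mulVg.
move=> /nbhs_mull; apply: filterS => x /=.
by rewrite fM morph_inv mulVKg.
Qed.

(** The image of an open set is cut out on the range by the union of the
    translates of the neighbourhoods given by the last hypothesis. *)
Lemma embedding_of_nbhs : injective f -> continuous f ->
  (forall U : set G, nbhs (1%g : G) U -> exists2 W : set H, nbhs (1%g : H) W & f @^-1` W `<=` U) ->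
  topological_group_embedding f.
Proof.
move=> fI fc fU; split=> // U oU.
have /choice[W hW] : forall u : G, exists W : set H, U u ->
    nbhs (1%g : H) W /\ forall g, W (f g) -> U (u * g)%g.
  move=> u; have [Uu|nU] := pselect (U u); last by exists setT => /nU.
  have [|W nW hW] := fU [set g | U (u * g)%g]; last by exists W.
  by apply: nbhs_mull; rewrite mulg1; exact: open_nbhs_nbhs.
exists (\bigcup_(u in U) interior [set k | W u ((f u)^-1 * k)%g]).
  by apply: bigcup_open => u _; exact: open_interior.
apply/seteqP; split.
  move=> _ [u Uu <-]; split; last by exists u.
  exists u => //; apply: nbhs_mull; rewrite mulVg; exact: (hW u Uu).1.
move=> k [[u Uu /interior_subset /= Wk] [g _ gk]]; exists g => //.
rewrite -[g](mulVKg u); apply: (hW u Uu).2.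
by rewrite fM morph_inv gk.
Qed.
End Embedding.

Section DirectProduct.
Variables (G H : groupType).
Definition dprodg : Type := (G * H)%type.
HB.instance Definition _ := Choice.copy dprodg (G * H)%type.
Definition dp_one : dprodg := (1%g, 1%g).
Definition dp_mul (x y : dprodg) : dprodg := (x.1 * y.1, x.2 * y.2)%g.
Definition dp_inv (x : dprodg) : dprodg := (x.1^-1, x.2^-1)%g.
Lemma dp_mulA : associative dp_mul.
Proof. by move=> x y z; rewrite /dp_mul /= !mulgA. Qed.
Lemma dp_mul1 : left_id dp_one dp_mul.
Proof. by move=> [x y]; rewrite /dp_mul /= !mul1g. Qed.
Lemma dp_mulr1 : right_id dp_one dp_mul.
Proof. by move=> [x y]; rewrite /dp_mul /= !mulg1. Qed.
Lemma dp_mulV : left_inverse dp_one dp_inv dp_mul.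
Proof. by move=> [x y]; rewrite /dp_mul /dp_inv /= !mulVg. Qed.
Lemma dp_mulrV : right_inverse dp_one dp_inv dp_mul.
Proof. by move=> [x y]; rewrite /dp_mul /dp_inv /= !mulgV. Qed.
HB.instance Definition _ := isGroup.Build dprodg dp_mulA dp_mul1 dp_mulr1 dp_mulV dp_mulrV.

Definition fst_act (A : iso_action G) : iso_action dprodg :=
  @IsoAction dprodg (space A) (fun g => act g.1) (fun g => act_iso g.1)
    (fun g h => @actM _ A g.1 h.1) (@act1 _ A).
End DirectProduct.

Section Main.
Variable G : topologicalGroupType.

Let L := tower_lim (base_space G).
Let Q := sep L.
Let H := isom_group L.

Definition rho (g : G) : H := isom_group_of_auto (lim_map_auto (base_act_auto g)).

Lemma rhoM : {morph rho : x y / (x * y)%g}.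
Proof.
move=> g h; apply: isom_group_eq => x /=; apply: sep_eq; apply/to_sep_dist.
have -> : base_act (g * h)%g = fun x => base_act g (base_act h x).
  by apply/funext => z; exact: base_act_mul.
rewrite lim_map_comp.
have [isog _] := lim_map_auto (base_act_auto g).
by apply/isog/dist_sym/rep_dist.
Qed.

Lemma rho_dist g (x : base_space G) c :
  dist_le (to_sep (to_tower_lim x) : Q) (sval (rho g) (to_sep (to_tower_lim x))) c
  <-> dist_le x (base_act g x) c.
Proof.
have -> : sval (rho g) (to_sep (to_tower_lim x)) =
    to_sep (to_tower_lim (base_act g x)).
  rewrite /= -lim_map_to; apply: sep_eq; apply/to_sep_dist.
  have [isog _] := lim_map_auto (base_act_auto g).
  exact/isog/rep_dist.
have := to_sep_dist (to_tower_lim x) (to_tower_lim (base_act g x)) c.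
by have := @to_tower_lim_isometry (base_space G) x (base_act g x) c; tauto.
Qed.

Lemma rho_near (F : seq (Q * rat)) : positive_radii (A := isom_group_act L) F ->
  nbhs (1%g : G) [set g | forall xd, List.In xd F -> dist_le xd.1 (sval (rho g) xd.1) xd.2].
Proof.
elim: F => [|[x d] F IH] pF; first by apply: filterS filterT => g _ xd [].
have {}IH := IH (fun xd hxd => pF xd (or_intror hxd)).
have d0 : 0 < d by exact: (pF (x, d) (or_introl erefl)).
have [A [pA hA]] := small_lim_map (sval x) d0.
have nA : nbhs (1%g : G) [set g | near_id_on (base_act g) A].
  elim: A pA {hA} => [|[y e] A IHA] pA; first by apply: filterS filterT => g _ xd [].
  have {}IHA := IHA (fun xd hxd => pA xd (or_intror hxd)).
  have := base_act_continuous y (pA (y, e) (or_introl erefl)).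
  move: IHA; apply: filterS2 => g h1 h2 xd [<-|] //; exact: h1.
move: IH nA; apply: filterS2 => g h1 h2 xd [<-|]; last exact: h1.
have h := hA _ (base_act_auto g) h2.
apply: dist_sym; rewrite /= -[X in dist_le _ X]to_sepK; exact/to_sep_dist.
Qed.

Lemma isom_group_homogeneous (p : letter Q) : valid p -> exists h : H,
  forall k ab, onth p k = Some ab -> dist_le (sval h ab.1) ab.2 0.
Proof.
move=> vp; pose q : letter L := [seq (sval ab.1, sval ab.2) | ab <- p].
have vq : valid q.
  move=> k l ab ab'; rewrite !onth_map.
  case hk: (onth p k) => [ab0|] //= -[<-].
  case hl: (onth p l) => [ab0'|] //= -[<-] c /=.
  exact: vp hk hl c.
have [f af hf] := lim_homogeneous vq; exists (isom_group_of_auto af) => k ab hk /=.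
rewrite -[ab.2]to_sepK; apply/to_sep_dist.
by apply: (hf k (sval ab.1, sval ab.2)); rewrite onth_map hk.
Qed.

Lemma isom_group_universal (E : distSpace) (v : nat -> E) : exists c : nat -> Q,
  forall n m e, dist_le (c n) (c m) e <-> dist_le (v n) (v m) e.
Proof.
have [c hc] := base_universal G v.
exists (fun n => to_sep (to_tower_lim (c n))) => n m e.
have := to_sep_dist (to_tower_lim (c n)) (to_tower_lim (c m)) e.
by have := @to_tower_lim_isometry (base_space G) (c n) (c m) e; have := hc n m e; tauto.
Qed.

Lemma rho_embeds (U : set G) : nbhs (1%g : G) U -> exists x : Q,
  forall g, dist_le x (sval (rho g) x) 2^-1 -> U g.
Proof.
move=> /nbsys_ex[V V0U].
exists (to_sep (to_tower_lim (inl (V, 1%g) : base_space G))) => g /rho_dist h.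
exact/V0U/base_act_near.
Qed.

Lemma rho_eq1 g : rho g = 1%g -> forall U, nbhs (1%g : G) U -> U g.
Proof.
move=> g1 U /rho_embeds[x]; apply; rewrite g1.
by apply: (dist_mono _ (dist_refl x)); rewrite invr_ge0.
Qed.

Lemma rho_injective : hausdorff_space G -> injective rho.
Proof.
move=> hG g h gh.
have e1 : rho (g^-1 * h)%g = 1%g.
  by rewrite rhoM -gh -rhoM mulVg; apply: (@mulgI _ (rho 1%g)); rewrite -rhoM !mulg1.
have : (1%g : G) = (g^-1 * h)%g.
  apply: hG => U V nU nV; exists (g^-1 * h)%g; split; first exact: rho_eq1 e1 U nU.
  exact: nbhs_singleton.
by move=> /(congr1 (mulg g)); rewrite mulg1 mulKVg.
Qed.

(** The two cases of the theorem share these facts: [K] is the group of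
    isometries, or its product with [G], acting through the isometries. *)
Section Represented.
Variables (K : groupType) (ka : K -> Q -> Q).
Hypothesis ka_iso : forall k, isometry (ka k).
Hypothesis kaM : forall k l x, ka (k * l)%g x = ka k (ka l x).
Hypothesis ka1 : forall x, ka 1%g x = x.
Let A : iso_action K := IsoAction ka_iso kaM ka1.
Hypothesis ka_surj : forall h : H, exists k, ka k = sval h.
Variable f : G -> K.
Hypothesis fM : {morph f : x y / (x * y)%g}.
Hypothesis fI : injective f.
Hypothesis f_act : forall g, ka (f g) = sval (rho g).

Lemma represented_embedding : topological_group_embedding (f : G -> ptw A).
Proof.
apply: embedding_of_nbhs => //.
  apply: morph_continuous => // U /ptw_nbhsP[F [pF hF]].
  apply: filterS (rho_near pF) => g hg; apply: hF => xd hxd /=.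
  by rewrite ka1 f_act; exact: hg.
move=> U /rho_embeds[x hx].
exists [set k : ptw A | dist_le x (ka k x) 2^-1]; last by move=> g /=; rewrite f_act; exact: hx.
apply/ptw_nbhsP; exists [:: (x, 2^-1)]; split; first by move=> xd [<-|].
move=> k /(_ (x, 2^-1)) /=; rewrite ka1; apply; by left.
Qed.

Lemma represented_extremely_amenable : extremely_amenable (ptw A).
Proof.
apply: ptw_extremely_amenable; last exact: isom_group_universal.
move=> p /isom_group_homogeneous[h hh]; have [k hk] := ka_surj h.
by exists k => n ab hn; rewrite /= hk; exact: hh hn.
Qed.

End Represented.

Lemma exists_embedding : exists (K : topologicalGroupType) (f : G -> K),
    [/\ topological_group_embedding f, extremely_amenable K &
        hausdorff_space G -> hausdorff_space K].
Proof.
have [hG|nG] := pselect (hausdorff_space G).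
  exists (ptw (isom_group_act L)), rho; split.
  - by apply: represented_embedding => //; [exact: rhoM|exact: rho_injective].
  - by apply: represented_extremely_amenable => h; exists h.
  - move=> _; apply: ptw_hausdorff => g h gh; apply: isom_group_eq => x.
    apply: sep_eq; exact: gh.
exists (ptw (fst_act G (isom_group_act L))), (fun g => (rho g, g)); split=> //.
- apply: represented_embedding => //; last by move=> g h [].
  by move=> g h; rewrite rhoM.
- by apply: represented_extremely_amenable => h; exists (h, 1%g).
Qed.

End Main.

Theorem corollary6p7 (G : topologicalGroupType) :
  exists (H : topologicalGroupType) (f : G -> H),
    [/\ topological_group_embedding f,
        extremely_amenable H &
        hausdorff_space G -> hausdorff_space H].
Proof. exact: exists_embedding. Qed.
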